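(* For every real $4\le p<\infty$ there is a constant $C_p>0$, depending only on $p$, such that the following holds for all positive integers $n,d$. Let $M_1,\dots,M_n$ be matchings on $[d]=\{1,\dots,d\}$ with adjacency matrices $A_1,\dots,A_n\in\mathbb{R}^{d\times d}$, and let $E=M_1\sqcup\cdots\sqcup M_n$ (disjoint union, i.e. edges counted with multiplicity). Define $\mu\in\mathbb{R}^n$ by $\mu_i=|M_i|$, and $\Delta\in\mathbb{R}^d$ by letting $\Delta_i$ be the degree of vertex $i$ in the multigraph $([d],E)$ (including multiplicities). If $g_1,\dots,g_n$ are i.i.d. standard Gaussian random variables, then $$ d^{\frac1p-\frac12}\,\mathbb{E}\Big\|\sum_{k=1}^ng_kA_k\Big\|_{\mathcal{I}_p}\le C_p\,(\log d)\,\|\mu\|_1^{\frac14}\,\|\Delta\|_\infty^{\frac1p}\,\|\mu\|_{\frac{2p-4}{p-4}}^{\frac12-\frac1p},$$ where for $p=4$ the exponent $\frac{2p-4}{p-4}$ is read as $\infty$.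
   Context: A matching on $[d]$ is a collection of pairwise disjoint unordered pairs (edges) of distinct elements of $[d]$; its adjacency matrix $A$ has $A_{i,j}=1$ if $\{i,j\}$ is in the matching and $A_{i,j}=0$ otherwise. For $B\in\mathbb{R}^{d\times d}$, $\|B\|_{\mathcal{I}_p}=\sup\{x^{\mathsf T}By : x,y\in\mathbb{R}^d,\ \|x\|_p\le1,\ \|y\|_p\le1\}$. For a vector $v$, $\|v\|_s$ is the usual $\ell_s$ norm. *)

(* Defs.v *)
From HB Require Import structures.
From mathcomp Require Export all_boot all_order all_algebra.
From mathcomp Require Export all_classical all_reals all_analysis.

Set Implicit Arguments.
Unset Strict Implicit.
Unset Printing Implicit Defensive.

Import Order.TTheory GRing.Theory Num.Theory.
Import numFieldNormedType.Exports.

Local Open Scope ring_scope.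

Section Matchings.
Variables n d : nat.

Definition is_matching (M : {set {set 'I_d}}) : bool :=
  [forall e in M, #|e| == 2%N] && finset.trivIset M.

(* A matching has no singleton blocks, so the diagonal entries vanish. *)
Definition adjacency (R : realType) (M : {set {set 'I_d}}) : 'M[R]_d :=
  \matrix_(i, j) ([set i; j]%SET \in M)%:R.

(* The disjoint union keeps the index of the matching an edge comes from, so
   an edge lying in several matchings is counted once for each of them. *)
Definition edge_union (M : 'I_n -> {set {set 'I_d}}) :
    {set 'I_n * {set 'I_d}} :=
  [set ke | ke.2 \in M ke.1]%SET.

Definition multidegree (E : {set 'I_n * {set 'I_d}}) (i : 'I_d) : nat :=
  #|[set ke in E | i \in ke.2]%SET|.

End Matchings.

Section Norms.
Variable R : realType.

(* Junk value 0 for the exponent -oo; only exponents in [1, +oo] are meant. *)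
Definition lnorm (m : nat) (s : \bar R) (v : 'cV[R]_m) : R :=
  match s with
  | r%:E => (\sum_i `|v i 0| `^ r) `^ r^-1
  | +oo%E => \big[Num.max/0]_i `|v i 0|
  | -oo%E => 0
  end.

Definition injective_norm (d : nat) (p : R) (B : 'M[R]_d) : R :=
  sup [set r : R | exists x y : 'cV[R]_d,
         [/\ lnorm p%:E x <= 1, lnorm p%:E y <= 1
           & r = (x^T *m B *m y) 0 0]]%classic.

(* (2p - 4) / (p - 4), read as +oo at p = 4. *)
Definition mu_exponent (p : R) : \bar R :=
  if p == 4 then +oo%E else ((2 * p - 4) / (p - 4))%:E.

End Norms.

Section Gaussians.
Context {disp : measure_display} {T : measurableType disp} {R : realType}.
Variables (P : probability T R) (n : nat).
Local Open Scope ereal_scope.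

Definition mutually_independent (X : 'I_n -> {RV P >-> R}) : Prop :=
  forall (J : {set 'I_n}) (B : 'I_n -> set R),
    (forall k, k \in J -> measurable (B k)) ->
    P (\bigcap_(k in [set` J]) (X k @^-1` B k))%classic =
    \prod_(k in J) P (X k @^-1` B k)%classic.

Definition iid_standard_gaussian (g : 'I_n -> {RV P >-> R}) : Prop :=
  mutually_independent g /\
  forall (k : 'I_n) (A : set R), measurable A ->
    distribution P (g k) A = normal_prob 0 1 A.

End Gaussians.

(* Main.v *)
(* Write m for the total number of edges and Dl for the maximal degree. Rescale
   the coordinates by s_i = sqrt (Delta_i + delta): the matrices
   H_k(i,j) = A_k(i,j) / (s_i s_j) have squares summing to a diagonal matrix
   (the A_k are matchings) with entries at most 1 / delta, so that by the
   noncommutative Khintchine inequality E |sum_k g_k H_k|_op is at most a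
   constant times sqrt (log d / delta). On the other hand |x|_p <= 1 implies
   sum_i s_i^2 x_i^2 <= C (Dl^(2/p) m^(1-2/p) + delta d^(1-2/p)), and choosing
   delta to balance the two terms gives
   d^(1/p-1/2) E |sum_k g_k A_k|_(I_p) <= C sqrt (log d) Dl^(1/p) m^(1/2-1/p).
   Finally m^(1/4-1/p) <= |mu|_((2p-4)/(p-4))^(1/2-1/p), the mu_k being natural
   numbers.

   The Khintchine inequality is proved by bounding E tr X^(2m) recursively:
   Gaussian integration by parts turns tr X^(2m+2) into terms
   tr (H_k X^j H_k X^(2m-j)), each of which is at most tr (H_k^2 X^(2m)). *)

Require Import Defs.
From mathcomp Require Import all_boot all_order all_algebra.
From mathcomp Require Import all_classical all_reals all_analysis.
From mathcomp Require Import measurable_realfun zify ring lra.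
From mathcomp Require mpoly.

Set Implicit Arguments.
Unset Strict Implicit.
Unset Printing Implicit Defensive.

Import Order.TTheory GRing.Theory Num.Theory.
Import numFieldNormedType.Exports.

Local Open Scope ring_scope.

(** * Trace inequalities *)

Section Traces.
Variable R : realFieldType.

(** Lagrange's identity: twice the difference of the two sides is the double sum of the squares
    [(a i * b j - a j * b i) ^+ 2]. *)
Lemma sum_cauchy_schwarz (I : finType) (a b : I -> R) :
  (\sum_i a i * b i) ^+ 2 <= (\sum_i a i ^+ 2) * (\sum_i b i ^+ 2).
Proof.
have : 0 <= \sum_i \sum_j (a i * b j - a j * b i) ^+ 2.
  by apply: sumr_ge0 => i _; apply: sumr_ge0 => j _; exact: sqr_ge0.
have -> : \sum_i \sum_j (a i * b j - a j * b i) ^+ 2 =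
  2 * ((\sum_i a i ^+ 2) * (\sum_i b i ^+ 2) - (\sum_i a i * b i) ^+ 2).
  transitivity (\sum_i \sum_j (a i ^+ 2 * b j ^+ 2 + b i ^+ 2 * a j ^+ 2
      - 2 * ((a i * b i) * (a j * b j)))).
    by apply: eq_bigr => i _; apply: eq_bigr => j _; ring.
  under eq_bigr do rewrite sumrB big_split/= -!mulr_sumr.
  rewrite sumrB big_split/= -!mulr_suml -mulr_sumr -mulr_suml; ring.
lra.
Qed.

Lemma mxtrace_cauchy_schwarz m n (A B : 'M[R]_(m, n)) :
  \tr (A^T *m B) ^+ 2 <= \tr (A^T *m A) * \tr (B^T *m B).
Proof.
have trE (C D : 'M[R]_(m, n)) :
    \tr (C^T *m D) = \sum_(ij : 'I_n * 'I_m) C ij.2 ij.1 * D ij.2 ij.1.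
  rewrite /mxtrace -(pair_bigA _ (fun i j => C j i * D j i))/=.
  by apply: eq_bigr => i _; rewrite mxE; apply: eq_bigr => j _; rewrite mxE.
by rewrite !trE; exact: sum_cauchy_schwarz.
Qed.

Lemma mxtrace_sqr_ge0 m n (A : 'M[R]_(m, n)) : 0 <= \tr (A^T *m A).
Proof.
apply: sumr_ge0 => i _; rewrite mxE; apply: sumr_ge0 => j _.
by rewrite mxE -expr2 sqr_ge0.
Qed.

Lemma trmxX n (A : 'M[R]_n.+1) k : (A ^+ k)^T = A^T ^+ k.
Proof. by elim: k => [|k IH]; rewrite ?trmx1// exprS exprSr trmx_mul IH. Qed.

Lemma mxtrace_even_ge0 n (X : 'M[R]_n.+1) k : X^T = X -> 0 <= \tr (X ^+ k.*2).
Proof.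
move=> sX; rewrite -addnn exprD -{1}sX -trmxX; exact: mxtrace_sqr_ge0.
Qed.

(* With f j = tr (H X^j H X^(N - j)), Cauchy-Schwarz for the Frobenius product
   makes f log-convex along even j; f being symmetric under j <-> N - j, it is
   largest at the end points. *)
Lemma mxtrace_shuffle n (X H : 'M[R]_n.+1) m j :
  X^T = X -> H^T = H -> (j <= m.*2)%N ->
  \tr (H * X ^+ j * H * X ^+ (m.*2 - j)) <= \tr (H * H * X ^+ m.*2).
Proof.
move=> sX sH.
pose f j := \tr (H * X ^+ j * H * X ^+ (m.*2 - j)).
have f0 : f 0%N = \tr (H * H * X ^+ m.*2) by rewrite /f expr0 mulr1 subn0.
rewrite -f0 -/(f j).
have fC k : (k <= m.*2)%N -> f (m.*2 - k)%N = f k.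
  move=> km; rewrite /f subKn// -!mulmxE mxtrace_mulC !mulmxA.
  rewrite -!mulmxA mxtrace_mulC !mulmxA.
  by rewrite -mulmxA mxtrace_mulC !mulmxA.
(* Splitting the outer power of [X] as [m - a] and [m - b] turns [f (a + b)] into the Frobenius
   product of [B a] and [B b]. *)
pose B a : 'M[R]_n.+1 := X ^+ a * H * X ^+ (m - a).
have BE a b : (a <= m)%N -> (b <= m)%N -> \tr ((B a)^T *m B b) = f (a + b)%N.
  move=> am bm; rewrite /B /f -!mulmxE !trmx_mul sH !trmxX sX.
  rewrite -!mulmxA mxtrace_mulC !mulmxA.
  have -> : (m.*2 - (a + b) = (m - b) + (m - a))%N.
    by lia.
  rewrite -(mulmxA H) !mulmxE -exprD -(mulrA _ _ (X ^+ (m - a))) -exprD.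
  by [].
have fge0 a : (a <= m)%N -> 0 <= f a.*2.
  by move=> am; rewrite -addnn -BE//; exact: mxtrace_sqr_ge0.
have fcs a b : (a <= m)%N -> (b <= m)%N -> f (a + b)%N ^+ 2 <= f a.*2 * f b.*2.
  by move=> am bm; rewrite -!addnn -!BE//; exact: mxtrace_cauchy_schwarz.
pose i0 := [arg max_(i > @ord0 m) f (val i).*2]%O.
have i0P (a : nat) : (a <= m)%N -> f a.*2 <= f (val i0).*2.
  move=> am; rewrite /i0; case: arg_maxP => //= i _ /(_ (inord a) isT)/=.
  by rewrite inordK.
have i0m : (i0 <= m)%N by rewrite -ltnS.
(* If an even maximum [b.*2] lies in the first half, then [b.*2.*2] is still admissible, and [f b.*2
   ^+ 2 <= f 0 * f b.*2.*2 <= f 0 * f b.*2] leaves no room for [f b.*2 > f 0]. *)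
have half b : (b.*2 <= m)%N -> (forall a, (a <= m)%N -> f a.*2 <= f b.*2) ->
    f b.*2 <= f 0%N.
  move=> bm bmax.
  have bm' : (b <= m)%N by apply: leq_trans bm; rewrite -addnn leq_addr.
  have [//|lt0] := leP (f b.*2) (f 0%N).
  have p0 : 0 <= f 0%N by apply: (fge0 0%N).
  have := fcs 0%N b.*2 (leq0n _) bm; rewrite add0n double0 => le2.
  have : f 0%N * f b.*2.*2 <= f 0%N * f b.*2 by rewrite ler_wpM2l// bmax.
  move=> /(le_trans le2); rewrite expr2 ler_pM2r; first by rewrite leNgt lt0.
  exact: le_lt_trans p0 lt0.
have fmax a : (a <= m)%N -> f a.*2 <= f 0%N.
  move=> am; apply: (le_trans (i0P _ am)).
  (* A maximum in the second half is reflected into the first by [fC]. *)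
  have [le|lt] := leqP (val i0).*2 m; first exact: half.
  have e : f (val i0).*2 = f (m - i0).*2.
    by rewrite doubleB fC// leq_double.
  rewrite e; apply: half => [|b bm]; last by rewrite -e i0P.
  rewrite doubleB leq_subLR -addnn leq_add2r; exact: ltnW.
move=> jm; have p0 : 0 <= f 0%N by apply: (fge0 0%N).
(* Every index, odd ones included, is a sum of two indices at most [m], so Cauchy-Schwarz reduces it
   to the even case. *)
have [a [b [am bm ->]]] : exists a b, [/\ (a <= m)%N, (b <= m)%N & j = (a + b)%N].
  exists (minn j m), (j - minn j m)%N; split; first exact: geq_minr.
    by rewrite leq_subLR; case: (leqP j m) => _; rewrite ?leq_addr// addnn.
  by rewrite subnKC// geq_minl.
have [neg|pos] := ltP (f (a + b)%N) 0; first exact: le_trans (ltW neg) p0.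
rewrite -(@ler_pXn2r _ 2)// ?nnegrE//; apply: (le_trans (fcs _ _ am bm)).
by rewrite expr2 ler_pM// ?fge0// fmax.
Qed.

(* <v, X^(2^k) v> =: a_k satisfies a_k^2 <= |v|^2 a_(k+1). *)
Lemma bilinear_le_mxtrace n (X : 'M[R]_n.+1) (u v : 'cV[R]_n.+1) (K : R) k :
  X^T = X -> \tr (u^T *m u) <= K -> \tr (v^T *m v) <= K ->
  (\tr (u^T *m X *m v)) ^+ (2 ^ k.+1) <= K ^+ (2 ^ k.+1) * \tr (X ^+ (2 ^ k.+1)).
Proof.
move=> sX uK vK.
have K0 : 0 <= K by exact: le_trans (mxtrace_sqr_ge0 u) uK.
pose a k := \tr (v^T *m (X ^+ (2 ^ k)) *m v).
have aE j : a j.+1 = \tr ((X ^+ (2 ^ j) *m v)^T *m (X ^+ (2 ^ j) *m v)).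
  rewrite /a expnS mul2n -addnn exprD -mulmxE.
  by rewrite trmx_mul trmxX sX !mulmxA.
have age0 j : 0 <= a j.+1 by rewrite aE mxtrace_sqr_ge0.
have step j : a j.+1 ^+ 2 <= K * a j.+2.
  rewrite {1}/a -mulmxA; apply: (le_trans (mxtrace_cauchy_schwarz _ _)).
  by rewrite -aE ler_wpM2r.
(* The extra factor [K] on the left replaces the exponent [2 ^ j - 1] of [K] on the right by
   [2 ^ j]. *)
have iter j : a 1%N ^+ (2 ^ j) * K <= K ^+ (2 ^ j) * a j.+1.
  elim: j => [|j IH]; first by rewrite !expr1 mulrC.
  have [->|Kn0] := eqVneq K 0.
    rewrite mulr0 mulr_ge0// exprn_ge0//.
  have Kp : 0 < K by rewrite lt_neqAle eq_sym Kn0.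
  rewrite expnSr !exprM -(ler_pM2l Kp).
  apply: (@le_trans _ _ ((a 1%N ^+ (2 ^ j) * K) ^+ 2)).
    by rewrite exprMn expr2 (expr2 K); lra.
  apply: (@le_trans _ _ ((K ^+ (2 ^ j) * a j.+1) ^+ 2)).
    by rewrite ler_pXn2r// nnegrE mulr_ge0// exprn_ge0.
  rewrite exprMn [leRHS]mulrCA ler_wpM2l//.
  by rewrite exprn_ge0// exprn_ge0.
(* The iteration ends by bounding the operator norm of [X ^+ (2 ^ k)] by its Frobenius norm. *)
have ub : a k.+1 <= K * \tr (X ^+ (2 ^ k.+1)).
  have sY : (X ^+ (2 ^ k))^T = X ^+ (2 ^ k) by rewrite trmxX sX.
  rewrite aE (_ : 2 ^ k.+1 = 2 ^ k + 2 ^ k)%N ?expnS ?mul2n ?addnn//.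
  rewrite -addnn exprD; set Y := X ^+ (2 ^ k) in sY *.
  have -> : \tr ((Y *m v)^T *m (Y *m v)) = \sum_i ((Y *m v) i 0) ^+ 2.
    rewrite trace_mx11 mxE.
    by apply: eq_bigr => i _; rewrite mxE -expr2.
  have -> : \tr (Y * Y) = \sum_i \sum_j Y i j ^+ 2.
    apply: eq_bigr => i _; rewrite mxE; apply: eq_bigr => j _.
    by rewrite -{2}sY mxE -expr2.
  rewrite mulr_sumr; apply: ler_sum => i _; rewrite mxE mulrC.
  apply: (le_trans (sum_cauchy_schwarz _ _)); rewrite ler_wpM2l//.
    by apply: sumr_ge0 => j _; exact: sqr_ge0.
  apply: le_trans vK; rewrite trace_mx11 mxE.
  by apply: ler_sum => j _; rewrite mxE -expr2.
have le1 : \tr (u^T *m X *m v) ^+ 2 <= K * a 1%N.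
  rewrite -mulmxA; apply: (le_trans (mxtrace_cauchy_schwarz _ _)).
  by rewrite (aE 0%N) expr1 ler_wpM2r// mxtrace_sqr_ge0.
have [K00|Kn0] := eqVneq K 0.
  have := le1; rewrite K00 mul0r => le0.
  have /eqP : \tr (u^T *m X *m v) ^+ 2 = 0.
    by apply/eqP; rewrite eq_le le0 sqr_ge0.
  by rewrite sqrf_eq0 => /eqP ->; rewrite !expr0n expn_eq0/= mul0r.
have Kp : 0 < K by rewrite lt_neqAle eq_sym Kn0.
rewrite {1 2}expnS !exprM -(ler_pM2r Kp).
apply: (@le_trans _ _ ((K * a 1%N) ^+ (2 ^ k) * K)).
  by rewrite ler_wpM2r// ler_pXn2r ?nnegrE ?expn_gt0// ?sqr_ge0// mulr_ge0.
rewrite exprMn -mulrA; apply: (@le_trans _ _ (K ^+ (2 ^ k) * (K ^+ (2 ^ k) * a k.+1))).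
  by rewrite ler_wpM2l// exprn_ge0.
rewrite mulrA -exprMn -expr2 -mulrA ler_wpM2l ?exprn_ge0// ?sqr_ge0//.
by rewrite mulrC.
Qed.
End Traces.

(** * Trace moments from integration by parts *)

(* [L] plays the role of the expectation of a polynomial in standard Gaussians
   [x k], [ev] of its pointwise evaluations, and [L (x k * a) = L (D k a)] is
   Gaussian integration by parts. *)
Section TraceMoments.
Variables (R : realFieldType) (A : comNzRingType) (n d : nat) (T : Type).
Variables (x : 'I_n -> A) (D : 'I_n -> A -> A) (c : {rmorphism R -> A}).
Variables (ev : T -> {rmorphism A -> R}) (L : A -> R).
Hypothesis D_add : forall k a b, D k (a + b) = D k a + D k b.
Hypothesis D_mul : forall k a b, D k (a * b) = D k a * b + a * D k b.
Hypothesis D_x : forall k j, D k (x j) = (k == j)%:R.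
Hypothesis D_c : forall k r, D k (c r) = 0.
Hypothesis ev_c : forall w r, ev w (c r) = r.
Hypothesis L_add : forall a b, L (a + b) = L a + L b.
Hypothesis L_c : forall r a, L (c r * a) = r * L a.
Hypothesis L1 : L 1 = 1.
Hypothesis L_le : forall a b, (forall w, ev w a <= ev w b) -> L a <= L b.
Hypothesis L_ibp : forall k a, L (x k * a) = L (D k a).
Variable H : 'I_n -> 'M[R]_d.+1.
Hypothesis H_sym : forall k, (H k)^T = H k.

(** The random matrix is kept formal, with entries in [A], so that the traces of its powers are
    elements to which [D] and [L] apply. *)
Definition gaussian_series : 'M[A]_d.+1 := \sum_k x k *: map_mx c (H k).
Local Notation X := gaussian_series.
Local Notation Hc k := (map_mx c (H k)).

Lemma derivation0 k : D k 0 = 0.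
Proof. by apply: (addrI (D k 0)); rewrite -D_add !addr0. Qed.

Lemma derivation_sum k (I : Type) (r : seq I) (P : pred I) F :
  D k (\sum_(i <- r | P i) F i) = \sum_(i <- r | P i) D k (F i).
Proof. by apply: big_morph; [exact: D_add|exact: derivation0]. Qed.

Lemma functional0 : L 0 = 0.
Proof. by apply: (addrI (L 0)); rewrite -L_add !addr0. Qed.

Lemma functional_sum (I : Type) (r : seq I) (P : pred I) F :
  L (\sum_(i <- r | P i) F i) = \sum_(i <- r | P i) L (F i).
Proof. by apply: big_morph; [exact: L_add|exact: functional0]. Qed.

Lemma map_derivation_mul k (P Q : 'M[A]_d.+1) :
  map_mx (D k) (P * Q) = map_mx (D k) P * Q + P * map_mx (D k) Q.
Proof.
apply/matrixP => i j; rewrite !mxE derivation_sum -big_split; apply: eq_bigr => l _.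
by rewrite D_mul !mxE.
Qed.

Lemma map_derivation_const k (B : 'M[R]_d.+1) :
  map_mx (D k) (map_mx c B) = 0.
Proof. by apply/matrixP => i j; rewrite !mxE D_c. Qed.

Lemma map_derivation_series k : map_mx (D k) X = Hc k.
Proof.
apply/matrixP => i j; rewrite !mxE summxE derivation_sum (bigD1 k)//= big1 => [|l lk].
  by rewrite !mxE D_mul D_x D_c eqxx mulr0 mul1r !addr0.
by rewrite !mxE D_mul D_x D_c eq_sym (negbTE lk) mul0r mulr0 addr0.
Qed.

Lemma map_derivation_exp k m :
  map_mx (D k) (X ^+ m) = \sum_(i < m) X ^+ i * Hc k * X ^+ (m.-1 - i).
Proof.
elim: m => [|m IH].
  rewrite big_ord0 expr0; apply/matrixP => i j; rewrite !mxE.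
  by rewrite -(rmorph_nat c) D_c.
rewrite exprSr map_derivation_mul IH map_derivation_series big_ord_recr/=.
rewrite subnn expr0 mulr1 mulr_suml; congr (_ + _); apply: eq_bigr => i _.
rewrite -mulrA -exprSr; congr (_ * X ^+ _).
by have := ltn_ord i; lia.
Qed.

Lemma derivation_mxtrace k (P : 'M[A]_d.+1) : D k (\tr P) = \tr (map_mx (D k) P).
Proof. by rewrite /mxtrace derivation_sum; apply: eq_bigr => i _; rewrite mxE. Qed.

(** The first factor of the power is expanded as the sum of the [x k *: Hc k] and each [x k] is
    integrated by parts; the Leibniz rule then replaces each of the remaining [m] factors in turn by
    [Hc k]. *)
Lemma moment_mxtrace_exprS m :
  L (\tr (X ^+ m.+1)) =
  \sum_k \sum_(i < m) L (\tr (Hc k * X ^+ i * Hc k * X ^+ (m.-1 - i))).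
Proof.
rewrite exprS {1}/gaussian_series mulr_suml raddf_sum functional_sum; apply: eq_bigr => k _.
rewrite -scalerAl /= mxtraceZ L_ibp derivation_mxtrace map_derivation_mul.
rewrite map_derivation_const mul0r add0r map_derivation_exp mulr_sumr.
by rewrite raddf_sum functional_sum; apply: eq_bigr => i _; rewrite !mulrA.
Qed.

Lemma ev_mxtrace w (P : 'M[A]_d.+1) : ev w (\tr P) = \tr (map_mx (ev w) P).
Proof. by rewrite trace_map_mx. Qed.

Lemma map_ev_const w (B : 'M[R]_d.+1) : map_mx (ev w) (map_mx c B) = B.
Proof. by apply/matrixP => i j; rewrite !mxE ev_c. Qed.

Definition ev_series w : 'M[R]_d.+1 := \sum_k ev w (x k) *: H k.

Lemma map_ev_series w : map_mx (ev w) X = ev_series w.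
Proof.
rewrite map_mx_sum; apply: eq_bigr => k _.
by rewrite map_mxZ map_ev_const.
Qed.

Lemma ev_series_sym w : (ev_series w)^T = ev_series w.
Proof.
by rewrite linear_sum; apply: eq_bigr => k _; rewrite linearZ /= H_sym.
Qed.

Variable s : R.
Hypothesis diag_s : forall i, (\sum_k H k * H k) i i <= s.
Hypothesis offdiag : forall i j, i != j -> (\sum_k H k * H k) i j = 0.

(** The sum of squares is diagonal, and an even power of a symmetric matrix has nonnegative diagonal
    entries, so the traces compare entry by entry. *)
Lemma mxtrace_variance_le m w :
  \tr ((\sum_k H k * H k) * ev_series w ^+ m.*2) <= s * \tr (ev_series w ^+ m.*2).
Proof.
rewrite /mxtrace mulr_sumr; apply: ler_sum => i _.
set V := \sum_k _; rewrite mxE (bigD1 i)//= big1 => [|j ji].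
  2: by rewrite offdiag ?mul0r// eq_sym.
rewrite addr0 ler_wpM2r//.
rewrite -addnn exprD -{1}ev_series_sym -trmxX mxE; apply: sumr_ge0 => j _.
by rewrite mxE -expr2 sqr_ge0.
Qed.

(** Each of the [m.*2.+1] terms of the integration by parts is bounded pointwise by
    [mxtrace_shuffle]; they all become the same trace, in which summing over [k] produces the
    variance matrix. *)
Lemma moment_mxtrace_step m :
  L (\tr (X ^+ m.+1.*2)) <= (m.*2.+1)%:R * s * L (\tr (X ^+ m.*2)).
Proof.
rewrite doubleS moment_mxtrace_exprS/=.
apply: (@le_trans _ _ (\sum_k \sum_(i < m.*2.+1) L (\tr (Hc k * Hc k * X ^+ m.*2)))).
  apply: ler_sum => k _; apply: ler_sum => i _; apply: L_le => w.
  rewrite !ev_mxtrace !rmorphM !rmorphXn/= !map_ev_const map_ev_series.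
  by apply: mxtrace_shuffle; rewrite ?ev_series_sym// -ltnS.
under eq_bigr do rewrite sumr_const card_ord.
rewrite sumrMnl -functional_sum -raddf_sum -mulr_suml -[leLHS]mulr_natl -mulrA ler_wpM2l//.
rewrite -L_c; apply: L_le => w; rewrite rmorphM ev_c !ev_mxtrace.
rewrite rmorphM !rmorphXn/= rmorph_sum/= map_ev_series.
under eq_bigr do rewrite rmorphM/= map_ev_const.
exact: mxtrace_variance_le.
Qed.

(** Fixing [M] in advance lets every factor [2j + 1] of the recursion be replaced by the constant
    [2M]. *)
Lemma moment_mxtrace_le M m : (m <= M)%N -> 0 <= s ->
  L (\tr (X ^+ m.*2)) <= (M.*2%:R * s) ^+ m * d.+1%:R.
Proof.
move=> mM s0; elim: m mM => [_|m IH mM].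
  rewrite !expr0 mul1r mxtrace1 -(rmorph_nat c) -[c _]mulr1 L_c L1 mulr1.
  by [].
apply: (le_trans (moment_mxtrace_step _)).
apply: (@le_trans _ _ (M.*2%:R * s * L (\tr (X ^+ m.*2)))).
  rewrite ler_wpM2r//; last by rewrite ler_wpM2r// ler_nat; lia.
  rewrite -functional0; apply: L_le => w; rewrite rmorph0 ev_mxtrace rmorphXn/= map_ev_series.
  by apply: mxtrace_even_ge0; exact: ev_series_sym.
rewrite exprS -[leRHS]mulrA ler_wpM2l ?IH ?(ltnW mM)//.
by rewrite mulr_ge0.
Qed.

End TraceMoments.

(** * Products of independent random variables *)

Section SimpleFunctions.
Import HBNNSimple.
Context {disp : measure_display} {T : measurableType disp} {R : realType}.


Lemma ge0_integral_mul_nnsfun (P : {measure set T -> \bar R}) (W Z : T -> R)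
    (h : {nnsfun R >-> R}) :
  measurable_fun setT W -> measurable_fun setT Z -> (forall w, 0 <= W w) ->
  (\int[P]_w (W w * h (Z w))%:E =
   \sum_(y \in range h) y%:E * \int[P]_w (W w * \1_(h @^-1` [set y]) (Z w))%:E)%E.
Proof.
move=> mW mZ W0.
have mI y : measurable_fun setT (fun w => W w * \1_(h @^-1` [set y]) (Z w)).
  apply: measurable_funM => //; apply: (measurableT_comp _ mZ).
  exact: measurable_indic.
transitivity (\int[P]_w (\sum_(y \in range h)
    (y%:E * (W w * \1_(h @^-1` [set y]) (Z w))%:E)))%E.
  apply: eq_integral => w _; rewrite fimfunE fsbig_finite//= mulr_sumr -sumEFin.
  rewrite fsbig_finite//=; apply: eq_bigr => y _.
  by rewrite -EFinM mulrCA.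
rewrite ge0_integral_fsum//=.
- apply: eq_fsbigr => y; rewrite inE => -[x _ <-].
  rewrite ge0_integralZl_EFin//.
  + by move=> w _; rewrite lee_fin mulr_ge0.
  + exact/measurable_EFinP.
- by move=> y; apply: measurable_funeM; exact/measurable_EFinP.
- move=> y w _; have [y0|y0] := leP 0 y; first by rewrite mule_ge0// lee_fin// mulr_ge0.
  by rewrite preimage_nnfun0// indic0 mulr0 mule0.
Qed.

End SimpleFunctions.

Section ChangeOfMeasure.
Import HBNNSimple.
Context {disp : measure_display} {T : measurableType disp} {R : realType}.

(** Monotone convergence extends the hypothesis from indicators to nonnegative functions. It serves
    twice: with [W] a product of the other independent factors, and with [W] the normal density. *)
Lemma ge0_integral_mul_comp (P : {measure set T -> \bar R})
    (nu : {measure set R -> \bar R}) (W Z : T -> R) (f : R -> R) (c : R) :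
  measurable_fun setT W -> measurable_fun setT Z -> measurable_fun setT f ->
  (forall w, 0 <= W w) -> (forall x, 0 <= f x) ->
  (forall B, measurable B ->
    \int[P]_w (W w * \1_B (Z w))%:E = c%:E * nu B)%E ->
  (\int[P]_w (W w * f (Z w))%:E = c%:E * \int[nu]_x (f x)%:E)%E.
Proof.
move=> mW mZ mf W0 f0 WB.
have mf' : measurable_fun setT (EFin \o f) by exact/measurable_EFinP.
pose h := nnsfun_approx measurableT mf'.
have step (g : {nnsfun R >-> R}) :
    (\int[P]_w (W w * g (Z w))%:E = c%:E * \int[nu]_x (g x)%:E)%E.
  have -> : (\int[nu]_x (g x)%:E = \int[nu]_x (cst 1 x * g (idfun x))%:E)%E.
    by apply: eq_integral => w _; rewrite mul1r.
  rewrite !ge0_integral_mul_nnsfun//; last exact: measurable_id.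
  have PE y : (\int[nu]_x (cst 1 x * \1_(g @^-1` [set y]) (idfun x))%:E =
      nu (g @^-1` [set y])%classic)%E.
    under eq_integral do rewrite mul1r.
    by rewrite integral_indic ?setIT.
  rewrite ge0_mule_fsumr => [|y]; last first.
    rewrite PE; have [y0|y0] := leP 0 y; first by rewrite mule_ge0.
    by rewrite preimage_nnfun0// measure0 mule0.
  by apply: eq_fsbigr => y _; rewrite PE WB// muleCA.
have lim d' (T' : measurableType d') (m : {measure set T' -> \bar R}) (V Y : T' -> R) :
    measurable_fun setT V -> measurable_fun setT Y -> (forall w, 0 <= V w) ->
    (\int[m]_w (V w * h n (Y w))%:E @[n --> \oo] -->
     \int[m]_w (V w * f (Y w))%:E)%E%classic.
  move=> mV mY V0.
  have -> : (\int[m]_w (V w * f (Y w))%:E =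
      \int[m]_w (lim ((V w * h n (Y w))%:E @[n --> \oo])%classic))%E.
    apply: eq_integral => w _; apply/esym/cvg_lim => //.
    under eq_fun do rewrite EFinM.
    rewrite EFinM; apply: cvgeZl => //.
    by apply: (cvg_nnsfun_approx measurableT mf') => // x _; rewrite lee_fin.
  apply: cvg_monotone_convergence => //.
  - move=> n; apply/measurable_EFinP/measurable_funM => //.
    exact: (measurableT_comp _ mY).
  - by move=> n w _; rewrite lee_fin mulr_ge0.
  - move=> w _ i j ij; rewrite lee_fin ler_wpM2l//.
    by have /lefP := nd_nnsfun_approx measurableT mf' ij; exact.
have l1 := lim _ _ P W Z mW mZ W0.
have l2 : (\int[P]_w (W w * h n (Z w))%:E @[n --> \oo] -->
    c%:E * \int[nu]_x (f x)%:E)%E%classic.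
  under eq_fun do rewrite step.
  apply: cvgeZl => //.
  have := lim _ _ nu (cst 1) idfun (measurable_cst _) (@measurable_id _ _ _) (fun=> ler01).
  under eq_fun do under eq_integral do rewrite mul1r.
  by under eq_integral do rewrite mul1r.
exact: (cvg_unique _ l1 l2).
Qed.

End ChangeOfMeasure.

Section IndependentProducts.
Context {disp : measure_display} {T : measurableType disp} {R : realType}.
Variables (P : probability T R) (n : nat) (g : 'I_n -> {RV P >-> R}).
Hypothesis g_indep : mutually_independent g.

Lemma measurable_prod_comp (I : seq 'I_n) (Q : pred 'I_n) (f : 'I_n -> R -> R) :
  (forall k, measurable_fun setT (f k)) ->
  measurable_fun setT (fun w => \prod_(k <- I | Q k) f k (g k w)).
Proof.
move=> mf; rewrite (_ : (fun w => _) = \prod_(k <- I | Q k) (f k \o g k)).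
  elim/big_ind : _ => [|u v mu mv|k _].
  - exact: measurable_cst.
  - exact: measurable_funM.
  - exact: measurableT_comp.
by apply/funext => w; rewrite fct_prodE.
Qed.

(** A product of indicators is the indicator of an intersection of events, so this is independence
    for the full index set. *)
Lemma ge0_integral_prod_indic (B : 'I_n -> set R) (e : 'I_n -> R) :
  (forall k, measurable (B k)) ->
  (forall k, \int[P]_w (\1_(B k) (g k w))%:E = (e k)%:E)%E ->
  (\int[P]_w (\prod_k \1_(B k) (g k w))%:E = (\prod_k e k)%:E)%E.
Proof.
move=> mB Be.
have mgB k : measurable (g k @^-1` B k)%classic.
  by rewrite -[X in measurable X]setTI; exact: measurable_funP.
have gBe k : (P (g k @^-1` B k)%classic = (e k)%:E)%E.
  rewrite -Be; transitivity (\int[P]_w (\1_(g k @^-1` B k)%classic w)%:E)%E => [|//].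
  by rewrite integral_indic ?setIT.
rewrite (big_morph EFin (@EFinM R) (erefl 1%:E)).
under [RHS]eq_bigr do rewrite -gBe.
have := g_indep (J := [set: 'I_n]%SET) (fun k _ => mB k).
under [X in _ = X -> _]eq_bigl do rewrite finset.in_setT.
move=> <-; set S := (\bigcap_(k in _) _)%classic.
have mS : measurable S.
  by apply: fin_bigcap_measurable => // k _; exact: mgB.
transitivity (\int[P]_w (\1_S w)%:E)%E; last by rewrite integral_indic ?setIT.
apply: eq_integral => w _; congr EFin.
have [Sw|Sw] := pselect (S w).
  rewrite indicE mem_set// big1// => k _; rewrite indicE mem_set//.
  by apply: Sw; rewrite /= inE.
have [k Bk] : exists k, ~ (B k (g k w)).
  apply: contrapT => /forallNP h; apply: Sw => k _; exact: contrapT (h k).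
by rewrite indicE memNset// (bigD1 k)//= indicE memNset// mul0r.
Qed.

(** Induction on the list [s] of factors not known to be indicators. With factor [j] replaced by an
    indicator the induction hypothesis applies, and [ge0_integral_mul_comp] passes from indicators
    back to [f j]. *)
Lemma ge0_integral_prod (s : seq 'I_n) (f : 'I_n -> R -> R) (e : 'I_n -> R) :
  (forall k, measurable_fun setT (f k)) -> (forall k x, 0 <= f k x) ->
  (forall k, \int[P]_w (f k (g k w))%:E = (e k)%:E)%E ->
  (forall k, k \notin s -> exists2 B, measurable B & f k = \1_B) ->
  (\int[P]_w (\prod_k f k (g k w))%:E = (\prod_k e k)%:E)%E.
Proof.
elim: s f e => [|j s IH] f e mf f0 fe sf.
  have /choice[B hB] : forall k, exists B, measurable B /\ f k = \1_B.
    by move=> k; have [//|B mB fB] := sf k; exists B.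
  rewrite -(@ge0_integral_prod_indic B).
  - by apply: eq_integral => w _; congr EFin; apply: eq_bigr => k _; rewrite (hB k).2.
  - by move=> k; exact: (hB k).1.
  - by move=> k; rewrite -(hB k).2.
pose W w := \prod_(k | k != j) f k (g k w).
have W0 w : 0 <= W w by exact: prodr_ge0.
have mW : measurable_fun setT W by exact: measurable_prod_comp.
have key (B : set R) : measurable B -> (\int[P]_w (W w * \1_B (g j w))%:E =
    (\prod_(k | k != j) e k)%:E * distribution P (g j) B)%E.
  move=> mB.
  have PB : (\int[P]_w (\1_B (g j w))%:E = distribution P (g j) B)%E.
    rewrite /distribution /pushforward.
    transitivity (\int[P]_w (\1_(g j @^-1` B)%classic w)%:E)%E => [//|].
    by rewrite integral_indic ?setIT// -[X in measurable X]setTI; exact: measurable_funP.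
  have pj : distribution P (g j) B = (fine (distribution P (g j) B))%:E.
    by rewrite fineK// fin_num_measure.
  rewrite [in RHS]pj -EFinM.
  pose f' k := if k == j then \1_B else f k.
  pose e' k := if k == j then fine (distribution P (g j) B) else e k.
  have -> : (\prod_(k | k != j) e k) * fine (distribution P (g j) B) = \prod_k e' k.
    rewrite [RHS](bigD1 j)//= {1}/e' eqxx mulrC; congr (_ * _).
    by apply: eq_bigr => k kj; rewrite /e' (negbTE kj).
  rewrite -(IH f' e').
  - apply: eq_integral => w _; congr EFin.
    rewrite [RHS](bigD1 j)//= {1}/f' eqxx mulrC; congr (_ * _).
    by apply: eq_bigr => k kj; rewrite /f' (negbTE kj).
  - move=> k; rewrite /f'; case: ifP => // _; exact: measurable_indic.
  - by move=> k x; rewrite /f'; case: ifP.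
  - move=> k; rewrite /f' /e'; case: eqP => [->|_]; last exact: fe.
    by rewrite -pj.
  - move=> k ks; rewrite /f'; case: eqP => [_|/eqP kj]; first by exists B.
    by apply: sf; rewrite inE negb_or kj.
have := @ge0_integral_mul_comp _ _ _ P (distribution P (g j)) W (g j) (f j) _
  mW _ (mf j) W0 (f0 j) key.
rewrite (_ : (\int[distribution P (g j)]_x (f j x)%:E = (e j)%:E)%E); last first.
  rewrite -fe ge0_integral_distribution//; first exact/measurable_EFinP.
  by move=> y; rewrite lee_fin.
rewrite -EFinM => h; rewrite [in RHS](bigD1 j)//= mulrC -h//.
by apply: eq_integral => w _; rewrite (bigD1 j)//= mulrC.
Qed.

Lemma integrable_prod (f : 'I_n -> R -> R) :
  (forall k, measurable_fun setT (f k)) ->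
  (forall k, P.-integrable setT (fun w => (f k (g k w))%:E)) ->
  P.-integrable setT (fun w => (\prod_k f k (g k w))%:E).
Proof.
move=> mf fi; apply/integrableP; split.
  by apply/measurable_EFinP; exact: measurable_prod_comp.
have fin k : (\int[P]_w `|f k (g k w)|%:E)%E \is a fin_num.
  rewrite ge0_fin_numE ?integral_ge0//.
  by have /integrableP[_] := fi k.
under eq_integral do rewrite /= normr_prod.
rewrite (@ge0_integral_prod (enum 'I_n) (fun k x => `|f k x|)
  (fun k => fine (\int[P]_w `|f k (g k w)|%:E)%E)) ?ltry//.
- by move=> k; exact: measurableT_comp.
- by move=> k; rewrite fineK.
- by move=> k; rewrite mem_enum.
Qed.

Lemma integral_prod (f : 'I_n -> R -> R) (e : 'I_n -> R) :
  (forall k, measurable_fun setT (f k)) ->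
  (forall k, P.-integrable setT (fun w => (f k (g k w))%:E)) ->
  (forall k, \int[P]_w (f k (g k w))%:E = (e k)%:E)%E ->
  (\int[P]_w (\prod_k f k (g k w))%:E = (\prod_k e k)%:E)%E.
Proof.
(* Here [s] lists the factors that may change sign; each induction step removes one of them. *)
suff H (s : seq 'I_n) : forall f e, (forall k, measurable_fun setT (f k)) ->
  (forall k, P.-integrable setT (fun w => (f k (g k w))%:E)) ->
  (forall k, \int[P]_w (f k (g k w))%:E = (e k)%:E)%E ->
  (forall k, k \notin s -> forall x, 0 <= f k x) ->
  (\int[P]_w (\prod_k f k (g k w))%:E = (\prod_k e k)%:E)%E.
  by move=> mf fi fe; apply: (H (enum 'I_n)) => // k; rewrite mem_enum.
elim: s {f e} => [|j s IH] f e mf fi fe s0.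
  apply: (@ge0_integral_prod (enum 'I_n)) => // [k x|k]; first exact: s0.
  by rewrite mem_enum.
(* f j = f+ - f- with f+ = (|f j| + f j) / 2 and f- = (|f j| - f j) / 2 *)
pose F (t : R) k x := if k == j then 2^-1 * (`|f j x| + t * f j x) else f k x.
have mF t k : measurable_fun setT (F t k).
  rewrite /F; case: (k == j) => //; apply: measurable_funM => //.
  apply: measurable_funD; first exact: measurableT_comp.
  exact: measurable_funM.
have FE t w : (F t j (g j w))%:E =
    (2^-1%:E * (`|f j (g j w)|%:E + t%:E * (f j (g j w))%:E))%E.
  by rewrite /F eqxx EFinM EFinD EFinM.
have ai : P.-integrable setT (fun w => `|f j (g j w)|%:E).
  exact: (integrable_abse (fi j)).
have ti t : P.-integrable setT (fun w => (t%:E * (f j (g j w))%:E)%E).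
  exact: integrableZl.
have Fi t k : P.-integrable setT (fun w => (F t k (g k w))%:E).
  have [->|kj] := eqVneq k j; last by rewrite /F (negbTE kj).
  rewrite (_ : (fun w => _) = (fun w => 2^-1%:E * (`|f j (g j w)|%:E + t%:E * (f j (g j w))%:E))%E).
    by apply: integrableZl => //; exact: integrableD.
  by apply/funext => w; rewrite FE.
pose a := fine (\int[P]_w `|f j (g j w)|%:E)%E.
pose E t k := if k == j then 2^-1 * (a + t * e j) else e k.
have FEe t k : (\int[P]_w (F t k (g k w))%:E = (E t k)%:E)%E.
  rewrite /E; case: eqP => [->|/eqP kj]; last by rewrite /F (negbTE kj).
  under eq_integral do rewrite FE.
  rewrite integralZl//; last exact: integrableD.
  rewrite integralD// integralZl// fe EFinM EFinD EFinM fineK//.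
  exact: integrable_fin_num.
have prodE t : \prod_k E t k = 2^-1 * (a + t * e j) * \prod_(k | k != j) e k.
  rewrite (bigD1 j)//= {1}/E eqxx; congr (_ * _).
  by apply: eq_bigr => k kj; rewrite /E (negbTE kj).
have prodF t w : \prod_k F t k (g k w) =
    2^-1 * (`|f j (g j w)| + t * f j (g j w)) * \prod_(k | k != j) f k (g k w).
  rewrite (bigD1 j)//= {1}/F eqxx; congr (_ * _).
  by apply: eq_bigr => k kj; rewrite /F (negbTE kj).
have F0 t : `|t| <= 1 -> forall k, k \notin s -> forall x, 0 <= F t k x.
  move=> t1 k ks x; rewrite /F; case: eqP => [_|/eqP kj].
    have := ler_norm (- (t * f j x)); rewrite normrN normrM => h.
    have h' : `|t| * `|f j x| <= `|f j x| by rewrite ler_piMl.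
    have h'' := le_trans h h'; rewrite mulr_ge0//.
    by rewrite -lerBlDr sub0r.
  by apply: s0; rewrite inE negb_or kj.
transitivity (\int[P]_w ((\prod_k F 1 k (g k w))%:E - (\prod_k F (-1) k (g k w))%:E))%E.
  apply: eq_integral => w _; rewrite -EFinB !prodF [in LHS](bigD1 j)//=.
  by congr EFin; field.
rewrite integralB_EFin//; [|exact: integrable_prod|exact: integrable_prod].
rewrite (IH _ (E 1))//; last by apply: F0; rewrite normr1.
rewrite (IH _ (E (-1)))//; last by apply: F0; rewrite normrN normr1.
by rewrite -EFinB !prodE [in RHS](bigD1 j)//=; congr EFin; field.
Qed.

End IndependentProducts.

(** * Gaussian moments *)

Section HalfMoments.
Variable R : realType.
Notation mu := (@lebesgue_measure R).
Notation phi := (normal_pdf (0 : R) 1).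

Lemma std_normal_pdfE x : phi x = normal_peak 1 * expR (- x ^+ 2 / 2).
Proof.
by rewrite normal_pdfE ?oner_neq0// /normal_fun subr0 expr1n.
Qed.

Lemma std_normal_pdfN x : phi (- x) = phi x.
Proof. by rewrite !std_normal_pdfE sqrrN. Qed.

Lemma is_derive_std_normal_pdf (x : R) : is_derive x (1 : R) phi (- x * phi x).
Proof.
have -> : phi = (fun x => normal_peak 1 * expR (- x ^+ 2 / 2)).
  by apply/funext => y; rewrite std_normal_pdfE.
apply: is_derive_eq.
by rewrite /GRing.scale/=; field.
Qed.

Lemma continuous_monomial_std_normal_pdf a :
  continuous (fun x : R => x ^+ a * phi x).
Proof.
move=> x; apply: cvgM; first exact: exprn_continuous.
by apply: continuous_normal_pdf; rewrite oner_neq0.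
Qed.

Lemma measurable_monomial_std_normal_pdf D a :
  measurable D -> measurable_fun D (fun x : R => x ^+ a * phi x).
Proof.
move=> mD; apply: measurable_funTS; apply: continuous_measurable_fun.
exact: continuous_monomial_std_normal_pdf.
Qed.

(** The term of order [a.+1] of the exponential series, at [x ^+ 2 / 2], already outweighs
    [x ^+ a.+1]. The bound makes the boundary terms of the integration by parts vanish at
    infinity. *)
Lemma monomial_std_normal_pdf_le a : exists C, forall x, 1 <= x ->
  x ^+ a * phi x <= C * x^-1.
Proof.
exists (normal_peak 1 * (2 ^+ a.+1 * (a.+1)`!%:R)) => x x1.
have x0 : 0 < x by lra.
have y0 : 0 <= x ^+ 2 / 2 by rewrite divr_ge0// sqr_ge0.
have := expR_ge1Dxn a y0; rewrite std_normal_pdfE mulNr expRN.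
set e := expR _ => he.
have e0 : 0 < e by exact: expR_gt0.
rewrite mulrCA -!mulrA ler_wpM2l ?normal_peak_ge0//.
rewrite ler_pdivrMr//.
have {}he : (x ^+ 2 / 2) ^+ a.+1 / (a.+1)`!%:R <= e by lra.
apply: (@le_trans _ _ (2 ^+ a.+1 * ((a.+1)`!%:R * (x^-1 * ((x ^+ 2 / 2) ^+ a.+1 / (a.+1)`!%:R))))).
  have f0 : (a.+1)`!%:R != 0 :> R by rewrite pnatr_eq0 -lt0n fact_gt0.
  have -> : 2 ^+ a.+1 * ((a.+1)`!%:R * (x^-1 * ((x ^+ 2 / 2) ^+ a.+1 / (a.+1)`!%:R)))
     = x^-1 * (x ^+ 2) ^+ a.+1.
    rewrite expr_div_n; field; rewrite f0 gt_eqF//= expf_neq0//.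
  rewrite -exprM mul2n doubleS exprS mulKf ?gt_eqF//.
  by rewrite ler_weXn2l// -addnn; lia.
rewrite -(mulrA (2 ^+ a.+1)) ler_pM2l ?exprn_gt0// -(mulrA _%:R) ler_wpM2l//.
by rewrite ler_wpM2l// invr_ge0 ltW.
Qed.

Lemma cvg_monomial_std_normal_pdf a :
  (i.+1%:R ^+ a * phi i.+1%:R @[i --> \oo] --> 0)%classic.
Proof.
have [C hC] := monomial_std_normal_pdf_le a.
apply: (@squeeze_cvgr _ _ _ _ (fun=> 0) (fun i => C * i.+1%:R^-1)).
- near=> i; rewrite mulr_ge0 ?exprn_ge0 ?normal_pdf_ge0//=.
  by apply: hC; rewrite ler1n.
- exact: cvg_cst.
- rewrite -(mulr0 C); apply: cvgM; first exact: cvg_cst.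
  exact: cvg_harmonic.
Unshelve. all: by end_near. Qed.

(** On the half-line the integrand is nonnegative, so the value is meaningful and a monotone limit
    over bounded intervals before finiteness is known. *)
Definition half_moment a : \bar R :=
  (\int[mu]_(x in `[0%R, +oo[) (x ^+ a * phi x)%:E)%E.

Lemma monomial_std_normal_pdf_ge0 a x : 0 <= x -> 0 <= x ^+ a * phi x.
Proof. by move=> x0; rewrite mulr_ge0 ?exprn_ge0 ?normal_pdf_ge0. Qed.

Lemma cvg_half_moment a :
  (\int[mu]_(x in `[0%R, i.+1%:R]) (x ^+ a * phi x)%:E @[i --> \oo]
     --> half_moment a)%E%classic.
Proof.
have -> : half_moment a = (\int[mu]_(x in (\bigcup_i `[0%R, i.+1%:R])%classic)
   (x ^+ a * phi x)%:E)%E.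
  congr (integral _ _ _); apply/seteqP; split => x /=; rewrite ?in_itv/=.
    rewrite andbT => x0; exists (Num.trunc x) => //=.
    by rewrite in_itv/= x0/= ltW// truncnS_gt.
  by case=> i _ /=; rewrite in_itv/= => /andP[->].
apply: ge0_nondecreasing_set_cvg_integral => //.
- move=> i j ij; apply/subsetPset => x /=; rewrite !in_itv/= => /andP[->/=].
  by move=> /le_trans; apply; rewrite ler_nat.
- move=> i; apply/measurable_EFinP.
  exact: measurable_monomial_std_normal_pdf.
- by move=> i x /=; rewrite in_itv/= lee_fin => /andP[x0 _];
    exact: monomial_std_normal_pdf_ge0.
Qed.

Lemma half_moment_ge0 a : (0 <= half_moment a)%E.
Proof.
apply: integral_ge0 => x /=; rewrite in_itv/= andbT lee_fin.
exact: monomial_std_normal_pdf_ge0.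
Qed.

Lemma integrable_itv_monomial a (b c : R) :
  mu.-integrable `[b, c] (fun x => (x ^+ a * phi x)%:E).
Proof.
apply: continuous_compact_integrable; first exact: segment_compact.
exact/continuous_subspaceT/continuous_monomial_std_normal_pdf.
Qed.

(** The fundamental theorem of calculus for [- (x ^+ a.+1 * phi x)], whose value at 0 vanishes. *)
Lemma itv_moment_rec a (c : R) : 0 < c ->
  (\int[mu]_(x in `[0%R, c]) (x ^+ a.+2 * phi x)%:E + (c ^+ a.+1 * phi c)%:E
   = a.+1%:R%:E * \int[mu]_(x in `[0%R, c]) (x ^+ a * phi x)%:E)%E.
Proof.
move=> c0.
pose F x : R := - (x ^+ a.+1 * phi x).
pose f x : R := x ^+ a.+2 * phi x - a.+1%:R * (x ^+ a * phi x).
have dF (y : R) : is_derive y (1 : R) F (f y).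
  have hX := @is_deriveX R R id a.+1 y 1 1 (is_derive_id _ _).
  have hF := is_deriveN (is_deriveM hX (is_derive_std_normal_pdf y)).
  have -> : F = - (id ^+ a.+1 * (phi : R -> R)).
    by apply/funext => z; rewrite /F !fctE.
  apply: is_derive_eq; rewrite !fctE.
  rewrite /f /GRing.scale/= ?mulr1 !exprS; ring.
have cont (g : R -> R) : continuous g -> {within `[0, c], continuous g}%classic.
  by move=> cg; exact/continuous_subspaceT.
have := @continuous_FTC2 R f F 0 c c0.
have -> : (\int[mu]_(x in `[0%R, c]) (f x)%:E =
  \int[mu]_(x in `[0%R, c]) (x ^+ a.+2 * phi x)%:E
  - a.+1%:R%:E * \int[mu]_(x in `[0%R, c]) (x ^+ a * phi x)%:E)%E.
  rewrite -integralZl//; last exact: integrable_itv_monomial.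
  rewrite -integralB//; first exact: integrable_itv_monomial.
  apply: integrableZl => //; exact: integrable_itv_monomial.
have fin b : (\int[mu]_(x in `[0%R, c]) (x ^+ b * phi x)%:E \is a fin_num)%E.
  by apply: integrable_fin_num => //; exact: integrable_itv_monomial.
rewrite -(fineK (fin a)) -(fineK (fin a.+2)).
set A := fine _; set B := fine _ => FTC.
have : (A%:E - a.+1%:R%:E * B%:E = (F c)%:E - (F 0)%:E)%E.
  apply: FTC.
  - apply: cont => x; apply: cvgB; first exact: continuous_monomial_std_normal_pdf.
    by apply: cvgM; [exact: cvg_cst|exact: continuous_monomial_std_normal_pdf].
  - have cF : continuous F.
      by move=> x; apply: cvgN; exact: continuous_monomial_std_normal_pdf.
    split; [by []|exact/cvg_at_right_filter/cF|exact/cvg_at_left_filter/cF].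
  - by move=> x _; rewrite derive1E derive_val.
rewrite -!EFinM -!EFinB -!EFinD => -[]; rewrite /F expr0n/= mul0r oppr0 => e.
congr EFin; lra.
Qed.

Lemma half_momentSS a : (half_moment a.+2 = a.+1%:R%:E * half_moment a)%E.
Proof.
have l1 : (\int[mu]_(x in `[0%R, i.+1%:R]) (x ^+ a.+2 * phi x)%:E +
   (i.+1%:R ^+ a.+1 * phi i.+1%:R)%:E @[i --> \oo] --> half_moment a.+2)%E%classic.
  rewrite -[half_moment _]adde0; apply: cvgeD.
  - by rewrite fin_num_adde_defl.
  - exact: cvg_half_moment.
  - by apply: cvg_EFin; [near=> i|exact: cvg_monomial_std_normal_pdf].
have l2 : (\int[mu]_(x in `[0%R, i.+1%:R]) (x ^+ a.+2 * phi x)%:E +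
   (i.+1%:R ^+ a.+1 * phi i.+1%:R)%:E @[i --> \oo] -->
   a.+1%:R%:E * half_moment a)%E%classic.
  under eq_fun do rewrite itv_moment_rec//.
  by apply: cvgeZl => //; exact: cvg_half_moment.
exact: (cvg_unique _ l1 l2).
Unshelve. all: by end_near. Qed.


(** The recursion has step two, so two starting values are required: order 0 is bounded by the total
    mass, and order 1 by orders 0 and 2 through [x <= 1 + x ^+ 2]. *)
Lemma half_moment_fin_num a : half_moment a \is a fin_num.
Proof.
have fin0 : (half_moment 0 < +oo)%E.
  apply: (@le_lt_trans _ _ (\int[mu]_x (phi x)%:E)%E).
    rewrite /half_moment; under eq_integral do rewrite expr0 mul1r.
    apply: ge0_subset_integral => //.
    - by apply/measurable_EFinP; exact: measurable_normal_pdf.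
    - by move=> x _; rewrite lee_fin normal_pdf_ge0.
  by rewrite integral_normal_pdf ltry.
have fin2 : (half_moment 2 < +oo)%E by rewrite half_momentSS mul1e.
have fin1 : (half_moment 1 < +oo)%E.
  apply: (@le_lt_trans _ _ (half_moment 0 + half_moment 2)%E).
    rewrite /half_moment -ge0_integralD//=.
    - apply: ge0_le_integral => //=.
      + by move=> x; rewrite in_itv/= andbT lee_fin; exact: monomial_std_normal_pdf_ge0.
      + by apply/measurable_EFinP; exact: measurable_monomial_std_normal_pdf.
      + apply/measurable_EFinP; apply: measurable_funD;
          exact: measurable_monomial_std_normal_pdf.
      + move=> x; rewrite in_itv/= andbT -EFinD lee_fin -mulrDl => x0.
        rewrite ler_wpM2r ?normal_pdf_ge0// expr0 expr1.
        by have := sqr_ge0 (x - 1); rewrite sqrrB1; lra.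
    - move=> x; rewrite in_itv/= andbT lee_fin; exact: monomial_std_normal_pdf_ge0.
    - by apply/measurable_EFinP; exact: measurable_monomial_std_normal_pdf.
    - by move=> x; rewrite in_itv/= andbT lee_fin; exact: monomial_std_normal_pdf_ge0.
    - by apply/measurable_EFinP; exact: measurable_monomial_std_normal_pdf.
  exact: lte_add_pinfty.
suff : (half_moment a < +oo)%E by move=> h; rewrite ge0_fin_numE ?half_moment_ge0.
suff [] : (half_moment a < +oo /\ half_moment a.+1 < +oo)%E by [].
elim: a => [//|a [h1 h2]]; split=> //.
by rewrite half_momentSS lte_mul_pinfty.
Qed.

Lemma half_moment_opp a :
  (\int[mu]_(x in `]-oo, 0%R]) (`|x| ^+ a * phi x)%:E = half_moment a)%E.
Proof.
have c : continuous (fun x : R => `|x| ^+ a * phi x).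
  move=> x; apply: cvgM; last first.
    by apply: continuous_normal_pdf; rewrite oner_neq0.
  apply: (@continuous_comp _ _ _ (fun x : R => `|x|) (fun x => x ^+ a)).
    exact: norm_continuous.
  exact: exprn_continuous.
have := @ge0_integration_by_substitutionNy R (fun x : R => `|x| ^+ a * phi x) 0.
rewrite oppr0 => ->.
- apply: eq_integral => x; rewrite inE/= in_itv/= andbT => x0.
  by rewrite normrN ger0_norm// std_normal_pdfN.
- exact/continuous_subspaceT.
- by move=> x _; rewrite mulr_ge0 ?exprn_ge0// normal_pdf_ge0.
Qed.

End HalfMoments.
Arguments half_moment {R} a.

Section GaussianMoments.
Context {disp : measure_display} {T : measurableType disp} {R : realType}.
Variables (P : probability T R) (X : {RV P >-> R}).
Hypothesis X_law : forall A, measurable A -> distribution P X A = normal_prob 0 1 A.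
Notation mu := (@lebesgue_measure R).
Notation phi := (normal_pdf (0 : R) 1).

Lemma ge0_integral_std_normal (f : R -> R) :
  measurable_fun setT f -> (forall x, 0 <= f x) ->
  (\int[P]_w (f (X w))%:E = \int[mu]_x (phi x * f x)%:E)%E.
Proof.
move=> mf f0.
pose id' : measurableTypeR R -> R := idfun.
have mid : measurable_fun setT id' := @measurable_id _ _ setT.
transitivity (\int[distribution P X]_x (f x)%:E)%E.
  by rewrite ge0_integral_distribution//; exact/measurable_EFinP.
rewrite -[LHS]mul1e -(@ge0_integral_mul_comp _ _ _ mu (distribution P X) phi id' f 1)//.
- exact: measurable_normal_pdf.
- by move=> x; exact: normal_pdf_ge0.
move=> B mB; rewrite mul1e [RHS]X_law// /normal_prob [RHS]integral_mkcond.
apply: eq_integral => x _; rewrite /= patchE indicE.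
by case: ifP => _; rewrite ?mulr1 ?mulr0.
Qed.

(** The power is cut at 0 into two nonnegative pieces, the sign [(-1) ^+ a] staying outside; the
    point 0 belongs to the right piece only. *)
Definition right_monomial a (x : R) := `|x| ^+ a * \1_(`[0%R, +oo[) x.
Definition left_monomial a (x : R) := `|x| ^+ a * \1_(`]-oo, 0%R[) x.

Lemma exprn_right_left a x :
  x ^+ a = right_monomial a x + (-1) ^+ a * left_monomial a x.
Proof.
rewrite /right_monomial /left_monomial !indicE !mem_setE !in_itv/= andbT.
case: leP => x0; first by rewrite ger0_norm// mulr1 !mulr0 addr0.
by rewrite mulr0 mulr1 add0r ltr0_norm// -exprMn mulN1r opprK.
Qed.

Lemma measurable_right_monomial a : measurable_fun setT (right_monomial a).
Proof.
apply: measurable_funM; last exact: measurable_indic.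
by apply: measurable_funX; exact: normr_measurable.
Qed.

Lemma measurable_left_monomial a : measurable_fun setT (left_monomial a).
Proof.
apply: measurable_funM; last exact: measurable_indic.
by apply: measurable_funX; exact: normr_measurable.
Qed.

Lemma right_monomial_ge0 a x : 0 <= right_monomial a x.
Proof. by rewrite mulr_ge0// exprn_ge0. Qed.

Lemma left_monomial_ge0 a x : 0 <= left_monomial a x.
Proof. by rewrite mulr_ge0// exprn_ge0. Qed.

Lemma integral_right_monomial a :
  (\int[P]_w (right_monomial a (X w))%:E = half_moment a)%E.
Proof.
rewrite ge0_integral_std_normal; last 2 first.
- exact: measurable_right_monomial.
- by move=> x; exact: right_monomial_ge0.
rewrite /half_moment [RHS]integral_mkcond; apply: eq_integral => x _.
rewrite patchE /right_monomial indicE mem_setE in_itv/= andbT.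
by case: ifP => x0; rewrite ?mulr0// ger0_norm// mulr1 mulrC.
Qed.

Lemma integral_left_monomial a :
  (\int[P]_w (left_monomial a (X w))%:E = half_moment a)%E.
Proof.
rewrite ge0_integral_std_normal; last 2 first.
- exact: measurable_left_monomial.
- by move=> x; exact: left_monomial_ge0.
rewrite -half_moment_opp -integral_itv_bndo_bndc; last first.
  apply: measurable_funTS; apply/measurable_EFinP; apply: measurable_funM.
    by apply: measurable_funX; exact: normr_measurable.
  exact: measurable_normal_pdf.
rewrite [RHS]integral_mkcond; apply: eq_integral => x _.
rewrite patchE /left_monomial indicE mem_setE in_itv/=.
by case: ifP => x0; rewrite ?mulr0// mulr1 mulrC.
Qed.

Lemma integrable_right_monomial a :
  P.-integrable setT (fun w => (right_monomial a (X w))%:E).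
Proof.
apply/integrableP; split.
  apply/measurable_EFinP; apply: (measurableT_comp (f := right_monomial a)) => //.
  exact: measurable_right_monomial.
under eq_integral do rewrite gee0_abs ?lee_fin ?right_monomial_ge0//.
by rewrite integral_right_monomial -ge0_fin_numE ?half_moment_fin_num ?half_moment_ge0.
Qed.

Lemma integrable_left_monomial a :
  P.-integrable setT (fun w => (left_monomial a (X w))%:E).
Proof.
apply/integrableP; split.
  apply/measurable_EFinP; apply: (measurableT_comp (f := left_monomial a)) => //.
  exact: measurable_left_monomial.
under eq_integral do rewrite gee0_abs ?lee_fin ?left_monomial_ge0//.
by rewrite integral_left_monomial -ge0_fin_numE ?half_moment_fin_num ?half_moment_ge0.
Qed.

(** By symmetry of the density the two half-lines contribute equally up to the sign [(-1) ^+ a], so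
    odd moments vanish. *)
Definition gaussian_moment a : R := (1 + (-1) ^+ a) * fine (half_moment a).

Lemma integrable_exprn_std_normal a :
  P.-integrable setT (fun w => (X w ^+ a)%:E).
Proof.
rewrite (_ : (fun w => _) = (fun w => (right_monomial a (X w))%:E +
    ((-1) ^+ a)%:E * (left_monomial a (X w))%:E)%E).
  apply: integrableD => //; first exact: integrable_right_monomial.
  by apply: integrableZl => //; exact: integrable_left_monomial.
by apply/funext => w; rewrite exprn_right_left EFinD EFinM.
Qed.

Lemma integral_exprn_std_normal a :
  (\int[P]_w (X w ^+ a)%:E = (gaussian_moment a)%:E)%E.
Proof.
have XE w : ((X w ^+ a)%:E = (right_monomial a (X w))%:E +
    ((-1) ^+ a)%:E * (left_monomial a (X w))%:E)%E.
  by rewrite exprn_right_left EFinD EFinM.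
under eq_integral do rewrite XE.
rewrite integralD//; last 2 first.
- exact: integrable_right_monomial.
- by apply: integrableZl => //; exact: integrable_left_monomial.
rewrite integralZl//; last exact: integrable_left_monomial.
rewrite integral_right_monomial integral_left_monomial /gaussian_moment.
by rewrite mulrDl mul1r EFinD EFinM fineK ?half_moment_fin_num.
Qed.

(** Gaussian integration by parts for monomials. At [a = 0] the truncated predecessor is harmless,
    its coefficient being 0. *)
Lemma gaussian_momentS a : gaussian_moment a.+1 = a%:R * gaussian_moment a.-1.
Proof.
case: a => [|a]; first by rewrite /gaussian_moment expr1 subrr !mul0r.
rewrite /gaussian_moment half_momentSS fineM ?half_moment_fin_num//= !exprS.
ring.
Qed.

End GaussianMoments.

(** * Polynomials in independent Gaussians *)


Section GaussianPolynomials.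
Import (canonicals, coercions) mpoly.
Context {disp : measure_display} {T : measurableType disp} {R : realType}.
Variables (P : probability T R) (n : nat) (g : 'I_n -> {RV P >-> R}).
Hypothesis g_gauss : iid_standard_gaussian g.
Local Notation poly := (mpoly.mpoly n R).
Local Notation var k := (mpoly.mpolyX R (mpoly.mnm1 k)).

Definition eval_at (w : T) : {rmorphism poly -> R} :=
  mpoly.meval (fun k => g k w).

Lemma eval_var w k : eval_at w (var k) = g k w.
Proof. exact: mpoly.mevalXU. Qed.

Lemma eval_const w c : eval_at w (mpoly.mpolyC n c) = c.
Proof. exact: mpoly.mevalC. Qed.

Lemma eval_monomial w m : eval_at w (mpoly.mpolyX R m) = \prod_k g k w ^+ m k.
Proof. exact: mpoly.mevalX. Qed.

Lemma eval_scale w c p : eval_at w (c *: p) = c * eval_at w p.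
Proof. exact: mpoly.mevalZ. Qed.

Let g_law k A : measurable A -> distribution P (g k) A = normal_prob 0 1 A.
Proof. by move=> mA; exact: g_gauss.2. Qed.

Lemma integrable_monomial m :
  P.-integrable setT (fun w => (eval_at w (mpoly.mpolyX R m))%:E).
Proof.
under eq_fun do rewrite eval_monomial.
apply: (integrable_prod g_gauss.1 (f := fun k x => x ^+ m k)) => k.
  exact: exprn_measurable.
exact: (integrable_exprn_std_normal (@g_law k)).
Qed.

Lemma integral_monomial m :
  (\int[P]_w (eval_at w (mpoly.mpolyX R m))%:E =
   (\prod_k gaussian_moment (m k))%:E)%E.
Proof.
under eq_integral do rewrite eval_monomial.
apply: (integral_prod g_gauss.1 (f := fun k x => x ^+ m k)) => k.
- exact: exprn_measurable.
- exact: (integrable_exprn_std_normal (@g_law k)).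
- exact: (integral_exprn_std_normal (@g_law k)).
Qed.

Lemma integrable_eval p : P.-integrable setT (fun w => (eval_at w p)%:E).
Proof.
elim/mpoly.mpolyind : p => [|c m p _ _ IH].
  by under eq_fun do rewrite rmorph0; exact: integrable0.
under eq_fun do rewrite rmorphD/= eval_scale EFinD EFinM.
by apply: integrableD => //; apply: integrableZl => //; exact: integrable_monomial.
Qed.

(** This is the functional [L] of the trace moments; [fine] loses nothing because [integrable_eval]
    makes every polynomial integrable. *)
Definition expect (p : poly) : R := fine (\int[P]_w (eval_at w p)%:E)%E.

Lemma expectE p : (\int[P]_w (eval_at w p)%:E = (expect p)%:E)%E.
Proof. by rewrite fineK//; apply: integrable_fin_num => //; exact: integrable_eval. Qed.

Lemma expectD p q : expect (p + q) = expect p + expect q.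
Proof.
rewrite /expect; under eq_integral do rewrite rmorphD EFinD.
by rewrite integralD//; [rewrite !expectE|exact: integrable_eval|exact: integrable_eval].
Qed.

Lemma expectZ c p : expect (c *: p) = c * expect p.
Proof.
rewrite /expect; under eq_integral do rewrite eval_scale EFinM.
by rewrite integralZl//; [rewrite !expectE|exact: integrable_eval].
Qed.

Lemma expect1 : expect 1 = 1.
Proof.
rewrite /expect; under eq_integral do rewrite rmorph1.
by rewrite integral_cst//= [P _]probability_setT mule1.
Qed.

Lemma expect_le p q : (forall w, eval_at w p <= eval_at w q) -> expect p <= expect q.
Proof.
move=> pq; rewrite -lee_fin -!expectE; apply: le_integral => //.
- exact: integrable_eval.
- exact: integrable_eval.
- by move=> w _; rewrite lee_fin.
Qed.

Lemma expect_monomial m : expect (mpoly.mpolyX R m) = \prod_k gaussian_moment (m k).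
Proof. by rewrite /expect integral_monomial. Qed.

(** By linearity it suffices to treat monomials; there independence factors both sides into moments,
    and only the [k]-th factor changes, by [gaussian_momentS]. *)
Lemma expect_ibp k p : expect (var k * p) = expect (mpoly.mderiv k p).
Proof.
elim/mpoly.mpolyind : p => [|c m p _ _ IH].
  by rewrite mulr0 mpoly.mderiv0.
rewrite mpoly.mderivD mpoly.mderivZ mulrDr !expectD IH -scalerAr !expectZ.
congr (c * _ + _).
rewrite -mpoly.mpolyXD mpoly.mderivX expectZ !expect_monomial.
rewrite (bigD1 k)//= [in RHS](bigD1 k)//= mpoly.mnmDE mpoly.mnm1E eqxx add1n.
rewrite gaussian_momentS mpoly.mnmBE mpoly.mnm1E eqxx subn1 -mulrA.
congr (_ * (_ * _)); apply: eq_bigr => j jk.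
by rewrite mpoly.mnmDE mpoly.mnmBE mpoly.mnm1E eq_sym (negbTE jk) add0n subn0.
Qed.

Lemma integral_mxtrace_le d (H : 'I_n -> 'M[R]_d.+1) (s : R) m :
  0 <= s -> (forall k, (H k)^T = H k) ->
  (forall i, (\sum_k H k * H k) i i <= s) ->
  (forall i j, i != j -> (\sum_k H k * H k) i j = 0) ->
  (\int[P]_w (\tr ((\sum_k g k w *: H k) ^+ m.*2))%:E <=
   ((m.*2%:R * s) ^+ m * d.+1%:R)%:E)%E.
Proof.
move=> s0 Hs Hd Ho.
pose x k : poly := var k.
have evE w : ev_series x eval_at H w = \sum_k g k w *: H k.
  by apply: eq_bigr => k _; rewrite eval_var.
pose cst : {rmorphism R -> poly} := @mpoly.mpolyC n R.
pose q : poly := \tr (gaussian_series x cst H ^+ m.*2).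
have qE w : eval_at w q = \tr ((\sum_k g k w *: H k) ^+ m.*2).
  rewrite /q (ev_mxtrace eval_at) rmorphXn/= (@map_ev_series _ _ _ _ _ x cst eval_at eval_const).
  by rewrite evE.
under eq_integral do rewrite -qE.
rewrite expectE lee_fin /q.
apply: (@moment_mxtrace_le _ _ n d T x (@mpoly.mderiv n R) cst eval_at expect
  _ _ _ _ _ _ _ _ _ _ H Hs s Hd Ho) => //.
- exact: mpoly.mderivD.
- exact: mpoly.mderivM.
- move=> k j; rewrite /x mpoly.mderivX mpoly.mnm1E eq_sym; case: eqP => [->|_].
    rewrite scale1r (_ : mpoly.mnm_sub _ _ = mpoly.mnm0) ?mpoly.mpolyX0//.
    by apply/mpoly.mnmP => i; rewrite mpoly.mnmBE mpoly.mnm0E subnn.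
  by rewrite scale0r.
- exact: mpoly.mderivC.
- exact: eval_const.
- exact: expectD.
- by move=> r a; rewrite /cst/= mpoly.mul_mpolyC expectZ.
- exact: expect1.
- exact: expect_le.
- exact: expect_ibp.
Qed.

Lemma measurable_mxtrace d (H : 'I_n -> 'M[R]_d.+1) m :
  measurable_fun setT (fun w => \tr ((\sum_k g k w *: H k) ^+ m)).
Proof.
pose x k : poly := var k.
pose cst : {rmorphism R -> poly} := @mpoly.mpolyC n R.
pose q : poly := \tr (gaussian_series x cst H ^+ m).
have qE w : eval_at w q = \tr ((\sum_k g k w *: H k) ^+ m).
  rewrite /q (ev_mxtrace eval_at) rmorphXn/= (@map_ev_series _ _ _ _ _ x cst eval_at eval_const).
  by congr (\tr (_ ^+ _)); apply: eq_bigr => k _; rewrite eval_var.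
under eq_fun do rewrite -qE.
by apply/measurable_EFinP; have /integrableP[] := integrable_eval q.
Qed.

End GaussianPolynomials.

(** * Weights and matchings *)

(** The integral of a nonnegative function is a supremum over the simple functions below it, and a
    larger function has more of them. This spares a proof that the injective norm is measurable in
    [w]. *)
Lemma le_integral_nonmeasurable d (T : measurableType d) (R : realType)
    (mu : {measure set T -> \bar R}) (f1 f2 : T -> R) :
  (forall x, 0 <= f1 x) -> (forall x, f1 x <= f2 x) ->
  (\int[mu]_x (f1 x)%:E <= \int[mu]_x (f2 x)%:E)%E.
Proof.
move=> f10 f12; rewrite !ge0_integralTE.
- apply: le_ereal_sup => _ [h hf1 <-]; exists h => // x.
  by apply: le_trans (hf1 x) _; rewrite lee_fin.
- by move=> x; rewrite lee_fin (le_trans (f10 x)).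
- by move=> x; rewrite lee_fin.
Qed.

Section WeightedSums.
Variable R : realType.

Lemma lnorm_le1 d (p : R) (x : 'cV[R]_d) : 0 < p ->
  lnorm p%:E x <= 1 -> \sum_i `|x i 0| `^ p <= 1.
Proof.
move=> p0 /= le1.
have S0 : 0 <= \sum_i `|x i 0| `^ p by apply: sumr_ge0 => i _; exact: powR_ge0.
rewrite -[leLHS]powRr1// -[X in _ `^ X <= _](@mulVf _ p) ?gt_eqF// powRrM.
apply: (@le_trans _ _ (1 `^ p)); last by rewrite powR1.
by apply: ge0_ler_powR => //; rewrite ?nnegrE ?powR_ge0 ?(ltW p0).
Qed.

(* Split according to whether |x i| is below a, with a^p = m / W. *)
Lemma weighted_sum_sqr_le d (p : R) (w : 'I_d -> R) (x : 'cV[R]_d) (m W : R) :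
  2 <= p -> 0 < m -> 0 < W -> (forall i, 0 <= w i <= m) -> \sum_i w i <= W ->
  \sum_i `|x i 0| `^ p <= 1 ->
  \sum_i w i * x i 0 ^+ 2 <= 2 * (m `^ (2 / p) * W `^ (1 - 2 / p)).
Proof.
move=> p2 m0 W0 wm wW x1.
have p0 : 0 < p by lra.
pose a := (m / W) `^ p^-1.
have a0 : 0 < a by rewrite powR_gt0// divr_gt0.
have ap : a `^ p = m / W.
  by rewrite /a -powRrM mulVf ?gt_eqF// powRr1// ltW// divr_gt0.
(* Below [a] the summand 1 suffices; above it, [p >= 2] gives that [y ^+ 2] is at most [a ^+ 2]
   times the [p]-th power of [y / a], and [W / m] is the inverse of the [p]-th power of [a]. *)
have key i : x i 0 ^+ 2 <= a ^+ 2 * (1 + `|x i 0| `^ p * (W / m)).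
  rewrite -real_normK ?num_real//; set y := `|x i 0|.
  have y0 : 0 <= y by exact: normr_ge0.
  have [ya|ay] := leP y a.
    apply: (@le_trans _ _ (a ^+ 2)); first by rewrite ler_pXn2r// nnegrE ltW.
    rewrite ler_peMr ?sqr_ge0// lerDl mulr_ge0 ?powR_ge0// ltW// divr_gt0//.
  have yp : 0 < y by exact: lt_trans ay.
  have split z : 0 < z -> z `^ p = z ^+ 2 * z `^ (p - 2).
    move=> z0; rewrite -powR_mulrn ?ltW// -powRD ?(gt_eqF z0) ?implybT//.
    by congr (_ `^ _); lra.
  have le : a `^ (p - 2) <= y `^ (p - 2).
    by apply: ge0_ler_powR; rewrite ?nnegrE ?subr_ge0// ltW.
  have -> : W / m = (a `^ p)^-1 by rewrite ap invf_div.
  rewrite (le_trans (y := a ^+ 2 * (y `^ p * (a `^ p)^-1)))//.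
    rewrite mulrA ler_pdivlMr ?(powR_gt0 p a0)//.
    rewrite (split _ yp) (split _ a0).
    by rewrite mulrCA ler_wpM2l ?sqr_ge0// ler_wpM2l ?sqr_ge0.
  by rewrite ler_wpM2l ?sqr_ge0// lerDr.
apply: (@le_trans _ _ (a ^+ 2 * (W + m * (W / m)))).
  apply: (@le_trans _ _ (\sum_i (a ^+ 2 * (w i + m * (`|x i 0| `^ p * (W / m)))))).
    apply: ler_sum => i _; have /andP[w0 wi] := wm i.
    apply: (le_trans (ler_wpM2l w0 (key i))).
    rewrite mulrCA ler_wpM2l ?sqr_ge0// mulrDr mulr1 lerD2l ler_wpM2r//.
    by rewrite mulr_ge0 ?powR_ge0// ltW// divr_gt0.
  rewrite -mulr_sumr ler_wpM2l ?sqr_ge0// big_split/= lerD//.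
  rewrite -mulr_sumr -mulr_suml ler_wpM2l ?(ltW m0)// ler_piMl// ltW//.
  exact: divr_gt0.
have -> : W + m * (W / m) = 2 * W by field; rewrite gt_eqF.
rewrite mulrCA ler_wpM2l//.
have -> : a ^+ 2 = m `^ (2 / p) * W `^ (- (2 / p)).
  rewrite -powR_mulrn ?ltW// /a -powRrM powRM ?invr_ge0 ?ltW//.
  by rewrite -(powR_inv1 (ltW W0)) -powRrM mulN1r [_^-1 * _]mulrC.
rewrite -mulrA ler_wpM2l ?powR_ge0//.
by rewrite powRD ?(gt_eqF W0) ?implybT// powRr1 ?(ltW W0)// mulrC.
Qed.

End WeightedSums.

Section MatchingMatrices.
Variables (R : realType) (d : nat).
Implicit Type M : {set {set 'I_d}}.

Lemma adjacencyT M : (adjacency R M)^T = adjacency R M.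
Proof. by apply/matrixP => i j; rewrite !mxE finset.setUC. Qed.

Lemma adjacency_sqr M i j : adjacency R M i j * adjacency R M i j = adjacency R M i j.
Proof. by rewrite mxE -natrM mulnb andbb. Qed.

(** Two edges through [j] must coincide, and then [i != l] would force [i = j], an edge with one
    element. Hence the square of an adjacency matrix is diagonal. *)
Lemma adjacency_disjoint M i j l : is_matching M -> i != l ->
  adjacency R M i j * adjacency R M j l = 0.
Proof.
move=> /andP[/forall_inP M2 tM] il; rewrite !mxE -natrM mulnb.
case: (boolP (_ && _)) => // /andP[ij jl].
have [e|ne] := eqVneq [set i; j]%SET [set j; l]%SET; last first.
  have /pred0P/(_ j) := finset.trivIsetP tM _ _ ij jl ne.
  by rewrite /= !inE eqxx orbT.
have := finset.set21 i j; rewrite e !inE (negbTE il) orbF => /eqP ij'.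
have := M2 _ ij; rewrite -ij' finset.setUid cards1.
by [].
Qed.

(** The map sending a neighbour [j] to the edge [[set i; j]] is injective. *)
Lemma sum_adjacency_le M i : is_matching M ->
  \sum_j adjacency R M i j <= #|[set e in M | i \in e]%SET|%:R.
Proof.
move=> /andP[/forall_inP M2 _].
under eq_bigr do rewrite mxE.
rewrite -natr_sum ler_nat.
rewrite (eq_bigr (fun j => if ([set i; j]%SET \in M) then 1%N else 0%N));
  last by move=> j _; case: (_ \in _).
rewrite -big_mkcond sum1_card.
rewrite -(card_in_imset (f := fun j => [set i; j]%SET)).
  apply/subset_leq_card/fintype.subsetP => e /imsetP[j jM ->].
  by rewrite inE finset.set21 andbT.
move=> j l jM lM e.
have ji : j != i.
  by apply: contraTneq (M2 _ jM) => ->; rewrite finset.setUid cards1.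
by have := finset.set22 i j; rewrite e !inE (negbTE ji) => /eqP.
Qed.

Lemma sum_degree M : is_matching M ->
  (\sum_i #|[set e in M | i \in e]%SET| = 2 * #|M|)%N.
Proof.
move=> /andP[/forall_inP M2 _].
under eq_bigr do rewrite -sum1_card.
rewrite (exchange_big_dep (fun e => e \in M)) /=; last first.
  by move=> i e _; rewrite inE => /andP[].
rewrite mulnC -sum_nat_const; apply: eq_bigr => e eM.
rewrite -(eqP (M2 _ eM)) -sum1_card; apply: eq_bigl => i.
by rewrite inE eM.
Qed.

Lemma multidegreeE n (M : 'I_n -> {set {set 'I_d}}) i :
  multidegree (edge_union M) i = (\sum_k #|[set e in M k | i \in e]%SET|)%N.
Proof.
rewrite /multidegree -sum1_card.
rewrite (eq_bigl (fun ke : 'I_n * {set 'I_d} => 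
    true && (ke.2 \in [set e in M ke.1 | i \in e]%SET))).
  rewrite -(pair_big_dep predT (fun k e => e \in [set e in M k | i \in e]%SET) (fun _ _ => 1%N))/=.
  by apply: eq_bigr => k _; rewrite sum1_card.
by move=> ke; rewrite !inE.
Qed.

End MatchingMatrices.

(** * The injective norm *)

(** Either [z <= K * t], or [z / K] exceeds [t] and is at most its power of order [N.+1] divided by
    [t ^+ N]. This trades a root of [b] for an expression affine in [b], whose expectation is
    immediate. *)
Lemma le_threshold (R : realFieldType) (z t b K : R) N :
  0 <= b -> 0 < t -> 0 < K -> z ^+ N.+1 <= K ^+ N.+1 * b ->
  z <= K * (t + b / t ^+ N).
Proof.
move=> b0 t0 K0 zb.
have [zt|tz] := leP z (K * t).
  by rewrite mulrDr (le_trans zt)// lerDl mulr_ge0 ?divr_ge0 ?exprn_ge0// ltW.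
have tz' : t < z / K by rewrite ltr_pdivlMr// mulrC.
rewrite mulrDr (le_trans (y := K * (b / t ^+ N)))//; last first.
  by rewrite lerDr mulr_ge0// ltW.
rewrite mulrC -ler_pdivrMr// ler_pdivlMr ?exprn_gt0//.
apply: (@le_trans _ _ ((z / K) ^+ N.+1)).
  rewrite exprS ler_pM2l; last exact: lt_trans tz'.
  by rewrite lerXn2r ?nnegrE ?ltW// (lt_trans t0).
by rewrite expr_div_n ler_pdivrMr ?exprn_gt0// mulrC.
Qed.

(** The diagonal factors are absorbed into the test vectors, whose squared Euclidean norms are then
    at most [K]; [bilinear_le_mxtrace] and [le_threshold] bound the form. Nonnegativity comes from
    the zero vectors. *)
Lemma injective_norm_le (R : realType) d (p : R) (s : 'rV[R]_d.+1)
    (Y : 'M[R]_d.+1) (K t : R) k :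
  Y^T = Y -> 0 < K -> 0 < t -> 0 < p ->
  (forall x : 'cV_d.+1, lnorm p%:E x <= 1 -> \sum_i (s 0 i * x i 0) ^+ 2 <= K) ->
  0 <= injective_norm p (diag_mx s *m Y *m diag_mx s) <=
    K * (t + \tr (Y ^+ (2 ^ k.+1)) / t ^+ (2 ^ k.+1).-1).
Proof.
move=> sY K0 t0 p0 xK; set B := K * _; rewrite /injective_norm; set S := (X in sup X).
have SB : ubound S B.
  move=> _ [x [y [x1 y1 ->]]].
  pose u := diag_mx s *m x; pose v := diag_mx s *m y.
  have sqE (z : 'cV_d.+1) : \tr ((diag_mx s *m z)^T *m (diag_mx s *m z)) =
      \sum_i (s 0 i * z i 0) ^+ 2 :> R.
    by rewrite trace_mx11 mxE; apply: eq_bigr => i _; rewrite mxE mul_diag_mx mxE expr2.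
  have -> : (x^T *m (diag_mx s *m Y *m diag_mx s) *m y) 0 0 = \tr (u^T *m Y *m v).
    by rewrite trace_mx11 /u /v trmx_mul tr_diag_mx !mulmxA.
  have N0 : (2 ^ k.+1 = (2 ^ k.+1).-1.+1)%N by rewrite prednK// expn_gt0.
  apply: le_threshold => //.
    rewrite expnS mul2n; exact: mxtrace_even_ge0.
  rewrite -N0; apply: bilinear_le_mxtrace => //.
    by rewrite sqE; exact: xK.
  by rewrite sqE; exact: xK.
have l0 : lnorm p%:E (0 : 'cV[R]_d.+1) <= 1.
  rewrite /= big1 ?powR0 ?invr_eq0 ?gt_eqF// => i _.
  by rewrite mxE normr0 powR0// gt_eqF.
have S0 : S 0 by exists 0, 0; split=> //; rewrite trmx0 !mul0mx mxE.
apply/andP; split; first by apply: ub_le_sup => //; exists B.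
by apply: ge_sup => //; exists 0.
Qed.

Section ExpectedNorm.
Context {disp : measure_display} {T : measurableType disp} {R : realType}.
Variables (P : probability T R) (n d : nat) (g : 'I_n -> {RV P >-> R}).
Hypothesis g_gauss : iid_standard_gaussian g.
Variables (p K sigma : R) (s : 'rV[R]_d.+1) (A : 'I_n -> 'M[R]_d.+1) (k : nat).
Hypotheses (p0 : 0 < p) (K0 : 0 < K) (sigma0 : 0 < sigma) (s0 : forall i, 0 < s 0 i).
Hypothesis A_sym : forall l, (A l)^T = A l.
Hypothesis ballK : forall x : 'cV_d.+1,
  lnorm p%:E x <= 1 -> \sum_i (s 0 i * x i 0) ^+ 2 <= K.
Let H l : 'M[R]_d.+1 := \matrix_(i, j) (A l i j / (s 0 i * s 0 j)).
Hypothesis diag_sigma : forall i, (\sum_l H l * H l) i i <= sigma.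
Hypothesis offdiag : forall i j, i != j -> (\sum_l H l * H l) i j = 0.
Hypothesis d_le : (d.+1 <= 2 ^ (2 ^ k.+1))%N.

(** With [N = 2 ^ k.+1], the moment bound carries a factor [d.+1], at most [2 ^ N] by [d_le]; this
    is the source of the 4 under the root and makes the expected trace at most [t ^+ N]. Then
    [K * (t + t ^+ N / t ^+ N.-1)] is [2 * K * t]. *)
Lemma expectation_injective_norm_le :
  (0 <= 'E_P[fun w => injective_norm p (\sum_l g l w *: A l)] <=
   (2 * K * Num.sqrt (4 * (2 ^ k.+1)%:R * sigma))%:E)%E.
Proof.
set N := (2 ^ k.+1)%N; set t := Num.sqrt _.
have NE : N = (2 ^ k).*2%N by rewrite /N expnS mul2n.
have N0 : (0 < N)%N by rewrite expn_gt0.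
have t0 : 0 < t by rewrite sqrtr_gt0 !mulr_gt0// ltr0n.
have Hs l : (H l)^T = H l.
  apply/matrixP => i j; rewrite !mxE mulrC [in RHS]mulrC (mulrC (s 0 j)).
  by rewrite -[in LHS]A_sym mxE.
pose Y w : 'M[R]_d.+1 := \sum_l g l w *: H l.
have sY w : (Y w)^T = Y w.
  by rewrite linear_sum; apply: eq_bigr => l _; rewrite linearZ/= Hs.
have XE w : \sum_l g l w *: A l = diag_mx s *m Y w *m diag_mx s.
  rewrite mulmx_sumr mulmx_suml; apply: eq_bigr => l _.
  rewrite -scalemxAr -scalemxAl; congr (_ *: _); apply/matrixP => i j.
  rewrite mul_mx_diag [RHS]mxE mul_diag_mx !mxE.
  by field; rewrite !gt_eqF.
have bnd w : 0 <= injective_norm p (\sum_l g l w *: A l) <=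
    K * (t + \tr (Y w ^+ N) / t ^+ N.-1).
  by rewrite XE; apply: injective_norm_le.
rewrite unlock; apply/andP; split.
  by apply: integral_ge0 => w _; rewrite lee_fin; have /andP[] := bnd w.
have mtr : measurable_fun setT (fun w => \tr (Y w ^+ N)) by exact: measurable_mxtrace.
have tr0 w : 0 <= \tr (Y w ^+ N) by rewrite NE; exact: mxtrace_even_ge0.
apply: (@le_trans _ _ (\int[P]_w (K * (t + \tr (Y w ^+ N) / t ^+ N.-1))%:E)%E).
  by apply: le_integral_nonmeasurable => w; have /andP[] := bnd w.
have trle : (\int[P]_w (\tr (Y w ^+ N))%:E <= (t ^+ N)%:E)%E.
  rewrite NE; apply: (le_trans (integral_mxtrace_le g_gauss _ (ltW sigma0) Hs diag_sigma offdiag)).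
  rewrite -NE lee_fin.
  have -> : t ^+ N = 4 ^+ (2 ^ k) * (N%:R * sigma) ^+ (2 ^ k).
    rewrite NE -mul2n exprM sqr_sqrtr; last by rewrite !mulr_ge0// ltW.
    by rewrite mul2n -NE -exprMn mulrA.
  rewrite mulrC ler_wpM2r ?exprn_ge0 ?mulr_ge0 ?(ltW sigma0)//.
  have -> : 4 ^+ (2 ^ k) = (2 ^ N)%:R :> R.
    by rewrite NE -mul2n expnM natrX.
  by rewrite ler_nat.
have -> : (\int[P]_w (K * (t + \tr (Y w ^+ N) / t ^+ N.-1))%:E =
   (K * t)%:E + (K / t ^+ N.-1)%:E * \int[P]_w (\tr (Y w ^+ N))%:E)%E.
  transitivity (\int[P]_w ((K * t)%:E + (K / t ^+ N.-1)%:E * (\tr (Y w ^+ N))%:E))%E.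
    by apply: eq_integral => w _; rewrite -EFinM -EFinD; congr EFin; ring.
  rewrite ge0_integralD//=.
  - rewrite integral_cst//= [P _]probability_setT mule1; congr (_ + _)%E.
    rewrite ge0_integralZl_EFin//.
    + by move=> w _; rewrite lee_fin.
    + exact/measurable_EFinP.
    + by rewrite divr_ge0 ?exprn_ge0 ?ltW.
  - by move=> w _; rewrite lee_fin mulr_ge0 ?ltW.
  - move=> w _; rewrite -EFinM lee_fin mulr_ge0//.
    by rewrite divr_ge0 ?exprn_ge0 ?ltW.
  - by apply: measurable_funeM; exact/measurable_EFinP.
apply: (@le_trans _ _ ((K * t)%:E + (K / t ^+ N.-1)%:E * (t ^+ N)%:E)%E).
  rewrite leeD2l// lee_wpmul2l// lee_fin divr_ge0 ?exprn_ge0//; exact: ltW.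
rewrite -EFinM -EFinD lee_fin -(prednK N0) exprS/=.
have tn : t ^+ N.-1 != 0 by rewrite expf_neq0// gt_eqF.
rewrite le_eqVlt; apply/orP; left; apply/eqP; field.
by rewrite tn.
Qed.

End ExpectedNorm.

(** * Rescaled adjacency matrices and the balanced choice of delta *)

Section Matchings.
Context {disp : measure_display} {T : measurableType disp} {R : realType}.
Variables (P : probability T R) (n d : nat) (g : 'I_n -> {RV P >-> R}).
Hypothesis g_gauss : iid_standard_gaussian g.
Variable M : 'I_n -> {set {set 'I_d.+1}}.
Hypothesis M_matching : forall l, is_matching (M l).
Local Notation Delta i := ((multidegree (edge_union M) i)%:R : R).

Lemma sum_multidegree :
  (\sum_i multidegree (edge_union M) i = 2 * \sum_l #|M l|)%N.
Proof.
under eq_bigr do rewrite multidegreeE.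
by rewrite exchange_big/= big_distrr; apply: eq_bigr => l _; exact: sum_degree.
Qed.

(* D^(-1/2) A_l D^(-1/2) with D = diag (s i ^ 2), s i ^ 2 = Delta i + delta:
   the squares sum to a diagonal matrix with entries at most 1 / delta. *)
Lemma normalized_adjacency_sqr (delta : R) (s : 'rV[R]_d.+1) :
  0 < delta -> (forall i, 0 < s 0 i) ->
  (forall i, s 0 i ^+ 2 = Delta i + delta) ->
  let H l : 'M[R]_d.+1 :=
    \matrix_(i, j) (adjacency R (M l) i j / (s 0 i * s 0 j)) in
  (forall i, (\sum_l H l * H l) i i <= delta^-1) /\
  (forall i j, i != j -> (\sum_l H l * H l) i j = 0).
Proof.
move=> d0 s0 sE H; split=> [i|i j ij]; last first.
  rewrite summxE big1// => l _; rewrite mxE big1// => h _; rewrite !mxE.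
  have := adjacency_disjoint R h (M_matching l) ij; rewrite !mxE => e.
  by rewrite mulrACA e mul0r.
have D0 j : 0 < s 0 j ^+ 2 by rewrite exprn_gt0.
rewrite summxE.
(* Only [1 / s_j^2] is bounded by [1 / delta]; the factor [1 / s_i^2] is kept, to cancel the row
   sums, which total at most [Delta i]. *)
apply: (@le_trans _ _ (\sum_l \sum_j adjacency R (M l) i j * (delta^-1 / s 0 i ^+ 2))).
  apply: ler_sum => l _; rewrite mxE; apply: ler_sum => j _; rewrite [H l i j]mxE [H l j i]mxE.
  have -> : adjacency R (M l) j i = adjacency R (M l) i j.
    by rewrite -[in LHS]adjacencyT mxE.
  rewrite mulrACA adjacency_sqr ler_wpM2l//; first by rewrite mxE.
  have -> : (s 0 i * s 0 j)^-1 * (s 0 j * s 0 i)^-1 = (s 0 j ^+ 2)^-1 / s 0 i ^+ 2.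
    by field; rewrite !gt_eqF.
  rewrite ler_wpM2r ?invr_ge0 ?sqr_ge0// lef_pV2 ?posrE//.
  by rewrite sE lerDr.
under eq_bigr do rewrite -mulr_suml.
rewrite -mulr_suml mulrCA ler_piMr ?invr_ge0 ?(ltW d0)//.
rewrite ler_pdivrMr// mul1r sE (le_trans (y := Delta i)) ?lerDl ?(ltW d0)//.
rewrite multidegreeE natr_sum; apply: ler_sum => l _; exact: sum_adjacency_le.
Qed.

Lemma expectation_matchings_le (p Dl W : R) k :
  4 <= p -> 0 < Dl -> 0 < W ->
  (forall i, Delta i <= Dl) -> \sum_i Delta i <= W ->
  (d.+1 <= 2 ^ (2 ^ k.+1))%N ->
  (((d.+1)%:R `^ (1 / p - 1 / 2))%:E *
     'E_P[fun w => injective_norm p (\sum_l g l w *: adjacency R (M l))] <=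
   (16 * Num.sqrt (2 ^ k.+1)%:R * (Dl `^ (1 / p) * W `^ (1 / 2 - 1 / p)))%:E)%E.
Proof.
move=> p4 Dl0 W0 DDl DW dk.
have p0 : 0 < p by lra.
pose a := Dl `^ (1 / p); pose b := W `^ (1 / 2 - 1 / p).
pose e := (d.+1)%:R `^ (1 / 2 - 1 / p) : R.
have a0 : 0 < a by exact: powR_gt0.
have b0 : 0 < b by exact: powR_gt0.
have e0 : 0 < e by apply: powR_gt0; rewrite ltr0n.
have sqrE (x z : R) : 0 < x -> x `^ z ^+ 2 = x `^ (2 * z).
  by move=> x0; rewrite -powR_mulrn ?powR_ge0// -powRrM mulrC.
have aE : Dl `^ (2 / p) = a ^+ 2 by rewrite sqrE//; congr (_ `^ _); ring.
have bE x : 0 < x -> x `^ (1 - 2 / p) = (x `^ (1 / 2 - 1 / p)) ^+ 2 :> R.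
  by move=> x0; rewrite sqrE//; congr (_ `^ _); field; rewrite gt_eqF.
(* With this choice [delta * e ^+ 2] equals [(a * b) ^+ 2], so the degrees and the constant shift
   contribute equally. *)
pose delta := (a * b / e) ^+ 2.
have delta0 : 0 < delta by rewrite exprn_gt0// divr_gt0// mulr_gt0.
pose s : 'rV[R]_d.+1 := \row_i Num.sqrt (Delta i + delta).
have Dd0 i : 0 < Delta i + delta by rewrite ltr_wpDl.
have sE i : s 0 i ^+ 2 = Delta i + delta by rewrite mxE sqr_sqrtr// ltW.
have s0 i : 0 < s 0 i by rewrite mxE sqrtr_gt0.
have [Hd Ho] := normalized_adjacency_sqr delta0 s0 sE.
(* Each of the two contributions is [2 * (a * b) ^+ 2], the 2 coming from [weighted_sum_sqr_le]. *)
pose K := 4 * (a * b) ^+ 2.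
have K0 : 0 < K by rewrite mulr_gt0// exprn_gt0// mulr_gt0.
have ballK (x : 'cV_d.+1) : lnorm p%:E x <= 1 -> \sum_i (s 0 i * x i 0) ^+ 2 <= K.
  move=> /(lnorm_le1 p0) x1.
  under eq_bigr do rewrite exprMn sE mulrDl.
  rewrite big_split/=.
  have h1 : \sum_i Delta i * x i 0 ^+ 2 <= 2 * (a ^+ 2 * b ^+ 2).
    rewrite -aE -bE//; apply: weighted_sum_sqr_le => //; first lra.
    by move=> i; rewrite DDl ler0n.
  have h2 : \sum_i delta * x i 0 ^+ 2 <= delta * (2 * e ^+ 2).
    rewrite -mulr_sumr ler_wpM2l ?(ltW delta0)//.
    under [leLHS]eq_bigr do rewrite -[_ ^+ 2]mul1r.
    have := @weighted_sum_sqr_le R d.+1 p (fun=> 1) x 1 (d.+1)%:R.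
    rewrite powR1 /= mul1r bE ?ltr0n// -/e.
    apply => //; first lra.
      by move=> _; rewrite ler01 lexx.
    by rewrite sumr_const card_ord.
  have := lerD h1 h2; rewrite /K /delta => /le_trans; apply.
  rewrite le_eqVlt; apply/orP; left; apply/eqP; field.
  by rewrite gt_eqF.
have invd : 0 < delta^-1 by rewrite invr_gt0.
have /andP[E0 EK] := @expectation_injective_norm_le _ _ _ P n d g g_gauss p K delta^-1 s
  (fun l => adjacency R (M l)) k p0 K0 invd s0 (fun l => adjacencyT R (M l)) ballK Hd Ho dk.
have -> : (d.+1)%:R `^ (1 / p - 1 / 2) = e^-1 :> R by rewrite -powRN opprB.
apply: (@le_trans _ _ (e^-1%:E * (2 * K * Num.sqrt (4 * (2 ^ k.+1)%:R * delta^-1))%:E)%E).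
  by rewrite lee_wpmul2l// lee_fin invr_ge0 ltW.
rewrite -EFinM lee_fin.
have -> : Num.sqrt (4 * (2 ^ k.+1)%:R * delta^-1) =
    2 * Num.sqrt (2 ^ k.+1)%:R * (e / (a * b)).
  have -> : 4 * (2 ^ k.+1)%:R * delta^-1 =
      (2 * (e / (a * b))) ^+ 2 * (2 ^ k.+1)%:R.
    by rewrite /delta; field; rewrite !gt_eqF.
  rewrite sqrtrM ?sqr_ge0// sqrtr_sqr ger0_norm.
    by rewrite mulrAC.
  by rewrite mulr_ge0// divr_ge0 ?mulr_ge0// ltW.
rewrite -/a -/b le_eqVlt; apply/orP; left; apply/eqP; rewrite /K; field.
by rewrite !gt_eqF.
Qed.

End Matchings.

(** * Logarithms and norms of the vector of matching sizes *)

Lemma sqrtr_le_self (R : realType) (x : R) : 1 <= x -> Num.sqrt x <= x.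
Proof.
move=> x1; have x0 : 0 <= x by lra.
rewrite -{2}(sqr_sqrtr x0) expr2 ler_peMr ?sqrtr_ge0//.
by rewrite -sqrtr1 ler_sqrt.
Qed.

(** The trace method takes an exponent that is a power of two. Rounding [l], the binary logarithm of
    [d] rounded up, to such a power gives at most [4 * l], and [l * ln 2 <= 2 * ln d] since
    [d >= 2]. *)
Lemma log_scale (R : realType) d : (2 <= d)%N ->
  exists2 k, (d <= 2 ^ (2 ^ k.+1))%N & (2 ^ k.+1)%:R <= 8 / ln 2 * ln d%:R :> R.
Proof.
move=> d2.
pose l := up_log 2 d.
have l0 : (0 < l)%N by rewrite /l up_log_gt0.
have [lt le] := andP (up_log_bounds (isT : (1 < 2)%N) d2).
exists (up_log 2 l).
  apply: (leq_trans le); rewrite leq_exp2l// expnS.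
  by have := up_logP l (isT : (1 < 2)%N); rewrite -/l; lia.
have kl : (2 ^ up_log 2 l <= 2 * l)%N.
  have [l1|l1] := leqP l 1.
    have -> : l = 1%N by lia.
    by rewrite up_log1.
  have /andP[h _] := up_log_bounds (isT : (1 < 2)%N) l1.
  rewrite -(prednK (_ : 0 < up_log 2 l)%N) ?up_log_gt0// expnS leq_pmul2l//.
  exact: ltnW.
have ln20 : 0 < ln 2 :> R by rewrite ln_gt0// ltr1n.
apply: (@le_trans _ _ (4 * l%:R)).
  by rewrite -natrM ler_nat expnS; lia.
rewrite mulrAC ler_pdivlMr//.
have lnd : ln 2 <= ln d%:R :> R by rewrite ler_ln ?posrE ?ltr0n ?ler_nat//; lia.
have lnl : l.-1%:R * ln 2 <= ln d%:R :> R.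
  rewrite -ln_powR powR_mulrn// -natrX ler_ln ?posrE ?ltr0n ?expn_gt0//; last by lia.
  by rewrite ler_nat ltnW.
have : l%:R = l.-1%:R + 1 :> R by rewrite natr1 prednK.
by move=> ->; nra.
Qed.

Section LNorms.
Variable R : realType.

Lemma lnorm1E n (f : 'I_n -> nat) :
  lnorm 1 (\col_k (f k)%:R : 'cV[R]_n) = (\sum_k f k)%N%:R.
Proof.
rewrite /lnorm/= invr1 powRr1; last by apply: sumr_ge0 => i _; exact: powR_ge0.
by rewrite natr_sum; apply: eq_bigr => i _; rewrite mxE normr_nat powRr1.
Qed.

Lemma le_lnorm_infty n (v : 'cV[R]_n) i : `|v i 0| <= lnorm +oo v.
Proof. by rewrite /lnorm; exact: (le_bigmax_cond _ (fun i => `|v i 0|)). Qed.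

(** Natural numbers do not exceed their powers of order [r >= 1], and
    [r^-1 * (1 / 2 - 1 / p) = 1 / 4 - 1 / p]. At [p = 4] the left side is 1, and some [f k] is at
    least 1. *)
Lemma powR_sum_le_lnorm n (f : 'I_n -> nat) (p : R) :
  4 <= p -> (0 < \sum_k f k)%N ->
  (\sum_k f k)%N%:R `^ (1 / 4 - 1 / p) <=
  lnorm (mu_exponent p) (\col_k (f k)%:R : 'cV[R]_n) `^ (1 / 2 - 1 / p).
Proof.
move=> p4 f0; rewrite /mu_exponent; case: eqP => [->|/eqP pn4].
  rewrite subrr powRr0.
  have [k fk] : exists k, (0 < f k)%N.
    apply/existsP; apply: contraTT f0 => /existsPn h.
    by rewrite big1// => k _; apply/eqP; rewrite -leqn0 leqNgt h.
  have le1 : 1 <= lnorm +oo (\col_k (f k)%:R : 'cV[R]_n).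
    by apply: le_trans (le_lnorm_infty _ k); rewrite mxE normr_nat ler1n.
  by rewrite -[leLHS](powRr0 (lnorm +oo (\col_k (f k)%:R : 'cV[R]_n))) ler_powR//; lra.
have p4' : 4 < p by rewrite lt_neqAle eq_sym pn4.
set r := (2 * p - 4) / (p - 4).
have r1 : 1 <= r by rewrite /r ler_pdivlMr ?subr_gt0//; lra.
rewrite /lnorm -powRrM.
have -> : r^-1 * (1 / 2 - 1 / p) = 1 / 4 - 1 / p.
  by rewrite /r; field; rewrite !gt_eqF//; lra.
apply: ge0_ler_powR.
- by rewrite subr_ge0 !mul1r lef_pV2 ?posrE//; lra.
- by rewrite nnegrE.
- by rewrite nnegrE; apply: sumr_ge0 => i _; exact: powR_ge0.
rewrite natr_sum; apply: ler_sum => k _; rewrite mxE normr_nat.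
case: (f k) => [|m]; first exact: powR_ge0.
by apply: le1r_powR => //; rewrite ler1n.
Qed.

End LNorms.

Theorem theorem2p4 (R : realType) (p : R) (hp : 4 <= p) :
  exists2 C : R, 0 < C &
  forall (n d : nat) (M : 'I_n -> {set {set 'I_d}})
    (disp : measure_display) (T : measurableType disp) (P : probability T R)
    (g : 'I_n -> {RV P >-> R}),
    let A : 'I_n -> 'M[R]_d := fun k => adjacency R (M k) in
    let E := edge_union M in
    let mu : 'cV[R]_n := \col_k #|M k|%:R in
    let Delta : 'cV[R]_d := \col_i (multidegree E i)%:R in
    (0 < n)%N -> (0 < d)%N ->
    (forall k, is_matching (M k)) ->
    iid_standard_gaussian g ->
    ((d%:R `^ (1 / p - 1 / 2))%:E *
       'E_P[fun w => injective_norm p (\sum_k g k w *: A k)]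
     <= (C * ln d%:R * lnorm 1 mu `^ (1 / 4) * lnorm +oo Delta `^ (1 / p) *
         lnorm (mu_exponent p) mu `^ (1 / 2 - 1 / p))%:E)%E.
Proof.
have ln20 : 0 < ln 2 :> R by rewrite ln_gt0// ltr1n.
(* The product of 16 from [expectation_matchings_le], [8 / ln 2] from [log_scale], and 2 from the
   total degree being twice the number of edges. *)
exists (256 / ln 2); first by rewrite divr_gt0.
move=> n [//|d] M disp T P g A E mu Delta _ _ M_matching g_gauss.
have lnd0 : 0 <= ln (d.+1)%:R :> R by rewrite ln_ge0// ler1n.
have rhs0 : 0 <= 256 / ln 2 * ln (d.+1)%:R * lnorm 1 mu `^ (1 / 4) *
    lnorm +oo Delta `^ (1 / p) * lnorm (mu_exponent p) mu `^ (1 / 2 - 1 / p).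
  by rewrite !mulr_ge0 ?powR_ge0 ?invr_ge0 ?(ltW ln20).
(* Without edges the random matrix is 0. Otherwise an edge makes the maximal degree and the edge
   count positive and forces at least two vertices, as [log_scale] requires. *)
have [/eqP M0|Mn0] := posnP (\sum_k #|M k|)%N.
  have A0 k : A k = 0.
    move: M0; rewrite sum_nat_eq0 => /forallP/(_ k)/=; rewrite cards_eq0 => /eqP Mk.
    by apply/matrixP => i j; rewrite !mxE Mk inE.
  have inj0 w : injective_norm p (\sum_k g k w *: A k) = 0.
    rewrite big1 => [|k _]; last by rewrite A0 scaler0.
    rewrite /injective_norm (_ : [set _ | _]%classic = [set 0]%classic) ?sup1//.
    apply/seteqP; split=> [_ [x [y [_ _ ->]]]|_ ->] /=.
      by rewrite mulmx0 mul0mx mxE.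
    exists 0, 0; split; rewrite ?mulmx0 ?mxE//.
      rewrite /= big1 ?powR0 ?invr_eq0 ?gt_eqF//; first lra.
      by move=> i _; rewrite mxE normr0 powR0// gt_eqF//; lra.
    rewrite /= big1 ?powR0 ?invr_eq0 ?gt_eqF//; first lra.
    by move=> i _; rewrite mxE normr0 powR0// gt_eqF//; lra.
  under [X in expectation _ X]eq_fun do rewrite inj0.
  by rewrite expectation_cst mule0 lee_fin.
have [k0 [e eM]] : exists k e, e \in M k.
  have /existsP[k] : [exists k, (0 < #|M k|)%N].
    apply: contraTT Mn0 => /existsPn h.
    by rewrite -leqNgt big1// => k _; apply/eqP; rewrite -leqn0 leqNgt h.
  by rewrite card_gt0 => /set0Pn[e eM]; exists k, e.
have e2 : #|e| = 2%N.
  by have /andP[/forall_inP/(_ _ eM)/eqP] := M_matching k0.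
have d2 : (2 <= d.+1)%N by rewrite -e2 -[leqRHS]card_ord max_card.
have [k dk kle] := log_scale R d2.
set Dl := lnorm +oo Delta; set m1 := lnorm 1 mu.
have m1E : m1 = (\sum_k #|M k|)%N%:R by rewrite /m1 lnorm1E.
have m10 : 0 < m1 by rewrite m1E ltr0n.
have DDl i : (multidegree E i)%:R <= Dl.
  by apply: le_trans (le_lnorm_infty _ i); rewrite mxE normr_nat.
have Dl0 : 0 < Dl.
  have /set0Pn[i ie] : e != finset.set0 by rewrite -card_gt0 e2.
  apply: lt_le_trans (DDl i); rewrite ltr0n /multidegree card_gt0.
  by apply/set0Pn; exists (k0, e); rewrite !inE eM.
have W0 : 0 < 2 * m1 by rewrite mulr_gt0.
have DW : \sum_i (multidegree E i)%:R <= 2 * m1.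
  by rewrite m1E -natr_sum sum_multidegree// natrM.
apply: (le_trans (expectation_matchings_le g_gauss M_matching hp Dl0 W0 DDl DW dk)).
rewrite lee_fin.
have pV : p^-1 <= 1 / 4 by rewrite mul1r lef_pV2 ?posrE//; lra.
have p0 : 0 < p^-1 by rewrite invr_gt0; lra.
have two : 2 `^ (1 / 2 - 1 / p) <= 2 :> R.
  by apply: ler1_powR; lra.
have mu_le := powR_sum_le_lnorm hp Mn0; rewrite -m1E in mu_le.
(* The first factor is the one in the claim; the second is absorbed by the last norm through
   [mu_le]. *)
have m1_split : m1 `^ (1 / 2 - 1 / p) = m1 `^ (1 / 4) * m1 `^ (1 / 4 - 1 / p).
  rewrite -powRD; last by rewrite (gt_eqF m10) implybT.
  by congr (_ `^ _); lra.
rewrite powRM ?(ltW m10)// m1_split.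
(* The argument yields the square root of the logarithmic scale; the claim allows the cruder full
   logarithm. *)
have sqrt_le : Num.sqrt (2 ^ k.+1)%:R <= 8 / ln 2 * ln (d.+1)%:R :> R.
  by apply: le_trans kle; apply: sqrtr_le_self; rewrite ler1n expn_gt0.
set q := _ `^ (1 / 2 - 1 / p) in mu_le *.
have -> : 256 / ln 2 * ln (d.+1)%:R * m1 `^ (1 / 4) * Dl `^ (1 / p) * q =
  16 * (8 / ln 2 * ln (d.+1)%:R) * (Dl `^ (1 / p) * (2 * (m1 `^ (1 / 4) * q))).
  by field; rewrite gt_eqF.
apply: ler_pM.
- by rewrite mulr_ge0// sqrtr_ge0.
- by rewrite !mulr_ge0 ?powR_ge0.
- by rewrite ler_wpM2l.
- rewrite ler_wpM2l ?powR_ge0// ler_pM ?mulr_ge0 ?powR_ge0//.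
  by rewrite ler_wpM2l ?powR_ge0.
Qed.
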